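(* Let $\Omega\subset\mathbb{R}^d\setminus\{0\}$ be a domain. (i) Suppose that $f\in W^{1,1}_{\mathcal H_a}(\Omega)$. Then $|\nabla_{\mathcal H_a}f|(\Omega)=\int_\Omega|\nabla_{\mathcal H_a}f(x)|\,dx$. (ii) (Lower semicontinuity) Suppose that $f_k\in\mathcal{BV}_{\mathcal H_a}(\Omega)$ for $k\in\mathbb{N}$ and $f_k\to f$ in $L^1_{loc}(\Omega)$. Then $$|\nabla_{\mathcal H_a}f|(\Omega)\le\liminf_{k\to\infty}|\nabla_{\mathcal H_a}f_k|(\Omega).$$
   Context: Let $d\ge 2$, $a\ge -(\frac d2-1)^2$, $\sigma:=\frac{d-2}{2}-\frac12\sqrt{(d-2)^2+4a}$. For $1\le i\le d$ put $A_{i,a}=\frac{\partial}{\partial x_i}+\sigma\frac{x_i}{|x|^2}$ and $A_{-i,a}=\frac{\partial}{\partial x_i}-\sigma\frac{x_i}{|x|^2}$ (derivatives in the sense of distributions when applied to nonsmooth functions). Set $\nabla_{\mathcal H_a}f=(A_{1,a}f,\dots,A_{d,a}f)$ and, for $\varphi\in C_c^1(\Omega,\mathbb{R}^d)$, $\mathrm{div}_{\mathcal H_a}\varphi=\sum_{i=1}^dA_{-i,a}\varphi_i$. The $\mathcal H_a$-variation of $f$ is $|\nabla_{\mathcal H_a}f|(\Omega)=\sup\int_\Omega f\,\mathrm{div}_{\mathcal H_a}\varphi\,dx\in[0,\infty]$ over $\varphi\in C_c^1(\Omega,\mathbb{R}^d)$ with $\sup_{x\in\Omega}|\varphi(x)|\le1$;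 the same formula is used for $f\in L^1_{loc}(\Omega)$. $\mathcal{BV}_{\mathcal H_a}(\Omega)$ is the set of $f\in L^1(\Omega)$ with $|\nabla_{\mathcal H_a}f|(\Omega)<\infty$. $W^{1,1}_{\mathcal H_a}(\Omega)$ is the set of $f\in L^1(\Omega)$ with $A_{j,a}f\in L^1(\Omega)$ for all $1\le j\le d$. *)

(* Defs.v *)
From HB Require Import structures.
From mathcomp Require Import all_boot all_order all_algebra.
From mathcomp Require Import all_classical all_reals all_analysis.
From mathcomp Require Import measurable_realfun.

Set Implicit Arguments.
Unset Strict Implicit.
Unset Printing Implicit Defensive.
Import Order.TTheory GRing.Theory Num.Theory.
Import numFieldNormedType.Exports.

Local Open Scope classical_set_scope.
Local Open Scope ring_scope.

(* The product sigma-algebra on row vectors, set up as the library does for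
   [n.-tuple T]; over the reals it is the Borel sigma-algebra
   ([measurable_rV_borel]). *)
Definition measure_rV_display : measure_display -> measure_display.
Proof. exact. Qed.

Section measurable_rV.
Context {d} {T : sigmaRingType d} (n : nat).

Let coord (i : 'I_n) (x : 'rV[T]_n) : T := x ord0 i.

Let rV_set0 : g_sigma_preimage coord set0.
Proof. exact: sigma_algebra0. Qed.

Let rV_setC A : g_sigma_preimage coord A -> g_sigma_preimage coord (~` A).
Proof. exact: sigma_algebraC. Qed.

Let rV_bigcup (F : (set _)^nat) : (forall i, g_sigma_preimage coord (F i)) ->
  g_sigma_preimage coord (\bigcup_i (F i)).
Proof. exact: sigma_algebra_bigcup. Qed.

HB.instance Definition _ := @isMeasurable.Build (measure_rV_display d)
  'rV[T]_n (g_sigma_preimage coord) rV_set0 rV_setC rV_bigcup.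

End measurable_rV.

Lemma measurable_coord d (T : sigmaRingType d) n (i : 'I_n) :
  measurable_fun [set: 'rV[T]_n] (fun x : 'rV[T]_n => x ord0 i).
Proof.
move=> _ Y mY; rewrite setTI; apply: sub_sigma_algebra => /=.
rewrite -bigcup_seq/=; exists i => /=; first by rewrite mem_index_enum.
by exists Y => //; rewrite setTI.
Qed.

Lemma measurable_fun_rVP d1 d2 (T1 : measurableType d1) (T2 : measurableType d2)
    n (f : T1 -> 'rV[T2]_n) :
  (forall i, measurable_fun [set: T1] (fun x => f x ord0 i)) ->
  measurable_fun [set: T1] f.
Proof.
move=> mf.
have sub : g_sigma_preimage (fun i => (fun x : 'rV[T2]_n => x ord0 i) \o f)
    `<=` measurable.
  apply: smallest_sub; first exact: sigma_algebra_measurable.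
  case: n => [|n] in f mf *; first by rewrite big_ord0.
  rewrite -bigcup_mkord_ord; apply: bigcup_sub => i Ii.
  by move=> A [B mB <-]; exact: mf.
move=> _ A mA; apply: sub; rewrite g_sigma_preimage_comp.
by exists A.
Qed.

Section lebesgue_rV.
Context {R : realType}.

Definition consrV n (p : measurableTypeR R * 'rV[R]_n) : 'rV[R]_n.+1 :=
  row_mx (p.1 : R)%:M p.2.

Lemma consrV0 n p : @consrV n p ord0 ord0 = p.1.
Proof. by rewrite mxE; case: splitP => // j _; rewrite !ord1 mxE. Qed.

Lemma consrVS n p (i : 'I_n) : consrV p ord0 (lift ord0 i) = p.2 ord0 i.
Proof.
rewrite mxE; case: splitP => [j|j /eqP].
  by rewrite ord1.
by rewrite /= /bump add1n eqSS => /eqP/val_inj ->.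
Qed.

Lemma measurable_consrV n : measurable_fun [set: _] (@consrV n).
Proof.
apply: measurable_fun_rVP => i; case: (unliftP ord0 i) => [j|] ->.
  under eq_fun do rewrite consrVS.
  apply: (@measurableT_comp _ _ _ _ _ _ (fun x : 'rV[R]_n => x ord0 j)) => //.
  exact: measurable_coord.
under eq_fun do rewrite consrV0.
exact: measurable_fst.
Qed.

Definition unconsrV n (x : 'rV[R]_n.+1) : measurableTypeR R * 'rV[R]_n :=
  (x ord0 ord0, \row_j x ord0 (lift ord0 j)).

Lemma consrVK n : cancel (@consrV n) (@unconsrV n).
Proof.
move=> [t x]; rewrite /unconsrV consrV0; congr pair.
by apply/rowP => j; rewrite mxE consrVS.
Qed.

Lemma measurable_unconsrV n : measurable_fun [set: _] (@unconsrV n).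
Proof.
apply/measurable_fun_pair; first exact: measurable_coord.
apply: measurable_fun_rVP => j.
under eq_fun do rewrite mxE.
exact: measurable_coord.
Qed.

Lemma preimage_consrV_box n (A : 'I_n.+1 -> set R) :
  @consrV n @^-1` [set x : 'rV[R]_n.+1 | forall i, A i (x ord0 i)] =
  (A ord0 : set (measurableTypeR R)) `*`
    [set x : 'rV[R]_n | forall i, A (lift ord0 i) (x ord0 i)].
Proof.
apply/seteqP; split => [p /= Ap|p [/= A0 A1] i].
  split => [|i] /=; first by have := Ap ord0; rewrite consrV0.
  by have := Ap (lift ord0 i); rewrite consrVS.
by case: (unliftP ord0 i) => [j|] ->; rewrite ?consrVS ?consrV0.
Qed.

Lemma measurable_box n (A : 'I_n -> set R) : (forall i, measurable (A i)) ->
  measurable [set x : 'rV[R]_n | forall i, A i (x ord0 i)].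
Proof.
move=> mA; rewrite (_ : mkset _ =
    \bigcap_(i in [set: 'I_n]) (fun x : 'rV[R]_n => x ord0 i) @^-1` A i).
  apply: fin_bigcap_measurable => // i _; rewrite -[X in measurable X]setTI.
  exact: (measurable_coord i).
by apply/seteqP; split => [x Ax i _|x Ax i]; [exact: Ax|exact: (Ax i)].
Qed.

Section lebesgue_cons.
Variables (n : nat) (m : {sigma_finite_measure set 'rV[R]_n -> \bar R}).

Definition lebesgue_cons : set 'rV[R]_n.+1 -> \bar R :=
  pushforward (@lebesgue_measure R \x m)%E (@consrV n).

Let lebesgue_cons0 : lebesgue_cons set0 = 0%E.
Proof. by rewrite /lebesgue_cons /pushforward preimage_set0 measure0. Qed.

Let lebesgue_cons_ge0 A : (0 <= lebesgue_cons A)%E.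
Proof. exact: (measure_ge0 (@lebesgue_measure R \x m)%E). Qed.

Let lebesgue_cons_sigma_additive : semi_sigma_additive lebesgue_cons.
Proof.
move=> F mF tF mUF; rewrite /lebesgue_cons /pushforward preimage_bigcup.
have mcF k : measurable (@consrV n @^-1` F k).
  by rewrite -[X in measurable X]setTI; exact: measurable_consrV.
apply: (measure_semi_sigma_additive (s := (@lebesgue_measure R \x m)%E)) => //.
- apply/trivIsetP => /= i j _ _ ij; rewrite -preimage_setI.
  by move/trivIsetP : tF => /(_ _ _ _ _ ij) ->//; rewrite preimage_set0.
- exact: bigcup_measurable.
Qed.

HB.instance Definition _ := isMeasure.Build _ _ _ lebesgue_cons
  lebesgue_cons0 lebesgue_cons_ge0 lebesgue_cons_sigma_additive.

Let lebesgue_cons_sigma_finite : sigma_finite setT lebesgue_cons.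
Proof.
have /sigma_finiteP[F [FT ndF Foo]] := sigma_finiteT (@lebesgue_measure R).
have /sigma_finiteP[G [GT ndG Goo]] := sigma_finiteT m.
exists (fun k => @unconsrV n @^-1` (F k `*` G k)).
  apply/esym; rewrite -subTset => x _.
  have [i _ Fi] : (\bigcup_k F k) (unconsrV x).1 by rewrite -FT.
  have [j _ Gj] : (\bigcup_k G k) (unconsrV x).2 by rewrite -GT.
  exists (maxn i j) => //; split.
    by move: Fi; exact/subsetPset/ndF/leq_maxl.
  by move: Gj; exact/subsetPset/ndG/leq_maxr.
move=> k; have [mF Fk] := Foo k; have [mG Gk] := Goo k; split.
  rewrite -[X in measurable X]setTI; apply: measurable_unconsrV => //.
  exact: measurableX.
rewrite /lebesgue_cons /pushforward -comp_preimage.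
rewrite (_ : _ \o _ = id); last by apply/funext; exact: consrVK.
by rewrite preimage_id product_measure1E// lte_mul_pinfty// ge0_fin_numE.
Qed.

HB.instance Definition _ := Measure_isSigmaFinite.Build _ _ _ lebesgue_cons
  lebesgue_cons_sigma_finite.

End lebesgue_cons.

(* Lebesgue measure on R^n, as the n-fold product of the one-dimensional one;
   see [lebesgue_rV_box] for its values on boxes. *)
Fixpoint lebesgue_rV n : {sigma_finite_measure set 'rV[R]_n -> \bar R} :=
  match n with
  | 0 => dirac (0 : 'rV[R]_0)
  | n'.+1 => lebesgue_cons (lebesgue_rV n')
  end.

Lemma lebesgue_rV_box n (A : 'I_n -> set R) : (forall i, measurable (A i)) ->
  lebesgue_rV n [set x : 'rV[R]_n | forall i, A i (x ord0 i)] =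
  (\prod_(i < n) @lebesgue_measure R (A i))%E.
Proof.
elim: n A => [|n IHn] A mA /=.
  rewrite big_ord0 (_ : mkset _ = setT) ?diracT//.
  by apply/seteqP; split => // x _ [].
rewrite /lebesgue_cons /pushforward preimage_consrV_box.
rewrite product_measure1E.
- rewrite big_ord_recl; congr (_ * _)%E.
  by apply: (IHn (fun i => A (lift ord0 i))) => i; exact: mA.
- exact: mA.
- exact: (measurable_box (fun i => mA (lift ord0 i))).
Qed.

Lemma open_measurable_rV n (U : set 'rV[R]_n) : open U -> measurable U.
Proof.
move=> oU.
pose box (p : 'rV[rat]_n * rat) : set 'rV[R]_n :=
  [set x | forall i, (ball (ratr (p.1 ord0 i) : R) (ratr p.2)) (x ord0 i)].
rewrite (_ : U = \bigcup_(p in [set p | box p `<=` U]) box p).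
  rewrite bigcup_mkcond; apply: countable_bigcupT_measurable => [|p].
    exact: countableP.
  case: ifPn => // _.
  apply: (measurable_box
    (A := fun i => ball (ratr (p.1 ord0 i) : R) (ratr p.2))) => i.
  exact: measurable_ball.
apply/seteqP; split => [x Ux|x [p /= pU]]; last exact: pU.
have /nbhs_ballP[e /= e0 eU] : nbhs x U by exact: open_nbhs_nbhs.
have [r /[!in_itv]/= /andP[r0 re]] := rat_in_itvoo (divr_gt0 e0 (@ltr0n R 2)).
have /choice[q qP] (i : 'I_n) : exists q : rat, `|ratr q - x ord0 i| < ratr r.
  have : x ord0 i - ratr r < x ord0 i + ratr r.
    by rewrite ltrD2l (lt_trans _ r0)// oppr_lt0.
  by move=> /rat_in_itvoo[q]; rewrite in_itv/= -ltr_distl; exists q.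
exists (\row_i q i, r) => [y|i] /=; last by rewrite mxE; exact: qP.
move=> boxy; apply: eU; split => // i j; rewrite (ord1 i) {i}.
have := boxy j; rewrite mxE => qy.
rewrite /ball/= (le_lt_trans (ler_distD (ratr (q j)) _ _))//.
by rewrite [ltRHS]splitr ltrD ?(lt_trans _ re)// distrC.
Qed.

Lemma measurable_rV_borel n :
  (@measurable _ 'rV[R]_n) = <<s [set U : set 'rV[R]_n | open U] >>.
Proof.
apply/seteqP; split; last first.
  apply: smallest_sub; first exact: sigma_algebra_measurable.
  exact: open_measurable_rV.
apply: smallest_sub; first exact: smallest_sigma_algebra.
case: n => [|n]; first by rewrite big_ord0.
rewrite -bigcup_mkord_ord; apply: bigcup_sub => i _ _ [B mB <-].
pose T := g_sigma_algebraType [set U : set 'rV[R]_n.+1 | open U].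
have mcoord : measurable_fun [set: T] (fun x : T => (x : 'rV[R]_n.+1) ord0 (inord i)).
  apply: (measurability _ (RGenOpens.measurableE R)) => _ [_ [a [b ->]] <-].
  rewrite setTI; apply: sub_sigma_algebra => /=.
  apply: (@open_comp _ _ (fun x : 'rV[R]_n.+1 => x ord0 (inord i))).
    by move=> x _; exact: coord_continuous.
  exact: interval_open.
exact: (mcoord measurableT _ mB).
Qed.
End lebesgue_rV.

Section smooth.
Context {R : realType} {n : nat}.
Implicit Types (W : normedModType R) (U : set 'rV[R]_n).

(* The library's norm [`|x|] on row vectors is the sup norm. *)
Definition enorm (x : 'rV[R]_n) : R := Num.sqrt (\sum_(i < n) x ord0 i ^+ 2).

Definition partial W (i : 'I_n) (g : 'rV[R]_n -> W) : 'rV[R]_n -> W :=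
  fun x => 'D_(delta_mx ord0 i) g x.

Definition partials W (s : seq 'I_n) (g : 'rV[R]_n -> W) : 'rV[R]_n -> W :=
  foldr (@partial W) g s.

Definition Ck_on W (k : nat) U (g : 'rV[R]_n -> W) : Prop :=
  forall (s : seq 'I_n) x, U x ->
    ((size s < k)%N ->
       forall i, derivable (partials s g) x (delta_mx ord0 i)) /\
    ((size s <= k)%N -> {for x, continuous (partials s g)}).

(* Elements of C^k_c(U) are represented by their extension by zero to R^n. *)
Definition Ck_c W (k : nat) U (g : 'rV[R]_n -> W) : Prop :=
  [/\ Ck_on k U g, compact (closure [set x | g x != 0]) &
      closure [set x | g x != 0] `<=` U].

Definition Cinfty_c W U (g : 'rV[R]_n -> W) : Prop :=
  forall k, Ck_c k U g.

Definition domain U : Prop := [/\ open U, connected U & U !=set0].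

Definition L1 U (f : 'rV[R]_n -> R) : Prop :=
  (lebesgue_rV n).-integrable U (EFin \o f).

Definition L1_loc U (f : 'rV[R]_n -> R) : Prop :=
  measurable_fun U f /\
  forall K, K `<=` U -> compact K -> L1 K f.

Definition cvg_L1_loc U (f_ : nat -> 'rV[R]_n -> R) (f : 'rV[R]_n -> R) : Prop :=
  [/\ forall k, L1_loc U (f_ k), L1_loc U f &
      forall K, K `<=` U -> compact K ->
        (fun k => \int[lebesgue_rV n]_(x in K) (`|f_ k x - f x|)%:E)%E @ \oo
          --> 0%E].

End smooth.

Section variation.
Context {R : realType} {d : nat} (a : R).
Implicit Types (Omega : set 'rV[R]_d) (f : 'rV[R]_d -> R).

Local Notation mu := (lebesgue_rV d).

Definition sigma : R :=
  (d%:R - 2) / 2 - Num.sqrt ((d%:R - 2) ^+ 2 + 4 * a) / 2.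

Definition drift (i : 'I_d) (x : 'rV[R]_d) : R :=
  sigma * (x ord0 i / enorm x ^+ 2).

Definition A_minus (i : 'I_d) (g : 'rV[R]_d -> R) (x : 'rV[R]_d) : R :=
  partial i g x - drift i x * g x.

Definition div_H (phi : 'rV[R]_d -> 'rV[R]_d) (x : 'rV[R]_d) : R :=
  \sum_(i < d) A_minus i (fun y => phi y ord0 i) x.

Definition variation_H Omega f : \bar R :=
  ereal_sup [set (\int[mu]_(x in Omega) (f x * div_H phi x)%:E)%E |
    phi in [set phi | Ck_c 1 Omega phi /\
                      forall x, Omega x -> enorm (phi x) <= 1]].

Definition BV_H Omega f : Prop :=
  L1 Omega f /\ (variation_H Omega f < +oo)%E.

(* The distribution A_{j,a} f = d_j f + sigma (x_j / |x|^2) f on Omega is (given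
   by) the function g. *)
Definition is_A_plus Omega (j : 'I_d) f (g : 'rV[R]_d -> R) : Prop :=
  forall psi : 'rV[R]_d -> R, Cinfty_c Omega psi ->
    ((\int[mu]_(x in Omega) (g x * psi x)%:E) =
     (- \int[mu]_(x in Omega) (f x * partial j psi x)%:E) +
     (\int[mu]_(x in Omega) (drift j x * f x * psi x)%:E))%E.

Definition W11_H Omega f : Prop :=
  L1 Omega f /\
  forall j : 'I_d, exists g, L1 Omega g /\ is_A_plus Omega j f g.

(* G is a representative of the gradient (A_{1,a} f, ..., A_{d,a} f), which as
   an element of L^1(Omega, R^d) is only defined almost everywhere. *)
Definition is_grad_H Omega f (G : 'rV[R]_d -> 'rV[R]_d) : Prop :=
  forall j : 'I_d, L1 Omega (fun x => G x ord0 j) /\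
                   is_A_plus Omega j f (fun x => G x ord0 j).

End variation.

(* Main.v *)
Require Import Defs.
From mathcomp Require Import all_boot all_order all_algebra.
From mathcomp Require Import all_classical all_reals all_analysis.
From mathcomp Require Import measurable_realfun.
From mathcomp Require Import ring lra.

Set Implicit Arguments.
Unset Strict Implicit.
Unset Printing Implicit Defensive.
Import Order.TTheory GRing.Theory Num.Theory.
Import numFieldNormedType.Exports.

Local Open Scope classical_set_scope.
Local Open Scope ring_scope.

(** Part (ii) is the usual argument for a supremum of linear functionals. For a
    fixed admissible field [phi] the function [div_H a phi] is bounded and
    vanishes off a compact subset of [Omega], so [f |-> \int f div_H phi] is
    continuous for the L^1_loc convergence; a supremum of continuous functionals
    is lower semicontinuous ([variation_lsc]). It matters here that [Omega] avoids
    the origin: the drift [sigma x_j / |x|^2] is then continuous on [Omega].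

    Part (i) has two halves. Integration by parts turns [\int f div_H phi] into
    [- \int G . phi], where [G] represents the gradient
    ([variation_integral]). By Cauchy-Schwarz this is at most [\int |G|], which
    gives one inequality. For the other, one wants to take for [phi] the field
    [u = - G / |G|], which is only measurable. Every component [u_j] is
    approximated by a compactly supported C^1 function [g_j] in the L^1 space of
    weight [|G|] ([C1_c_dense]), and the field [2 g / (1 + |g|^2)] is used: its
    norm is at most [1] whatever [g] is, and the identity

      [1 - 2 u . g / (1 + |g|^2) = |u - g|^2 / (1 + |g|^2)],  for [|u| = 1],

    shows that its defect is controlled by the L^1 distance of [g] to [u]
    ([norm_le_dot]).

    Both halves need a smoothing device. The weak gradient is tested against
    smooth functions only, whereas the variation uses C^1 fields; and the density
    of test functions in L^1 needs smooth functions converging to the indicator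
    of an open set. Instead of mollifying by a convolution in several variables,
    functions are interpolated on a grid of mesh [h]:

      [interp f x = \sum_k f (h k) \prod_i beta (x_i / h - k_i)],

    where [beta] is smooth with support in [[0, 3]] and its integer translates
    sum to [1]. This is a finite sum of tensor products, hence smooth, and it
    converges to [f] at each point of continuity. If moreover
    [beta' t = gamma t - gamma (t - 1)], where the translates of [gamma] also sum
    to [1], then a summation by parts shows that a partial derivative of the
    interpolant is the interpolant, with [gamma] in that coordinate, of the
    difference quotient of [f] ([interp_partial]), so it converges to the partial
    derivative of [f] when [f] is C^1. All convergences are pointwise with uniform bounds, which is what dominated
    convergence asks for ([open_indicator_approx], [Ck_c1_smooth_approx]). *)

(** * Smooth functions of one variable and a finite-difference spline *)

Section smooth1.
Context {R : realType}.
Implicit Types (f g : R -> R) (t : R).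

Lemma is_derive_comp f g df dg t : is_derive (g t) 1 f df ->
  is_derive t 1 g dg -> is_derive t 1 (fun u => f (g u)) (df * dg).
Proof.
move=> [/derivable1_diffP Df <-] [/derivable1_diffP Dg <-].
apply: DeriveDef; first exact/derivable1_diffP/differentiable_comp.
rewrite -derive1E -[fun u => _]/(f \o g) derive1_comp ?derive1E//;
  exact/derivable1_diffP.
Qed.

Lemma is_derive_affine f df (c b t : R) : is_derive (c * t + b) 1 f df ->
  is_derive t 1 (fun u => f (c * u + b)) (c * df).
Proof.
move=> dfP; rewrite mulrC; apply: is_derive_comp => //.
have -> : (fun u : R => c * u + b) = (c \*: id) + cst b by [].
by apply: is_derive_eq; rewrite addr0 /GRing.scale/= mulr1.
Qed.

(** The powers [t^-k] are built in so that the family is stable, up to linear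
    combinations, under derivation: this replaces the analysis of the successive
    derivatives of [exp (- 1 / t)]. *)
Definition flat (k : nat) t : R := if 0 < t then t ^- k * expR (- t^-1) else 0.

(** Since [exp y >= y^n / n!], the function decays at [0] faster than the factor
    [t^-k] blows up; two spare powers of [t] are what differentiability at [0]
    requires. *)
Lemma flat_le k t : 0 <= flat k t <= (k.+2)`!%:R * t ^+ 2.
Proof.
rewrite /flat; case: ifPn => [t0|_]; last first.
  by rewrite lexx mulr_ge0 ?sqr_ge0.
rewrite expRN mulr_ge0 ?invr_ge0 ?exprn_ge0 ?expR_ge0 ?(ltW t0)//=.
have := @expR_ge1Dxn R t^-1 k.+1 _; rewrite invr_ge0 ltW// => /(_ isT) h.
have {}h : t^-1 ^+ k.+2 / (k.+2)`!%:R <= expR t^-1.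
  by apply: le_trans h; rewrite lerDr.
have F0 : 0 < (k.+2)`!%:R :> R by rewrite ltr0n fact_gt0.
have p0 : 0 < t^-1 ^+ k.+2 / (k.+2)`!%:R.
  by rewrite divr_gt0// exprn_gt0// invr_gt0.
have {}h : (expR t^-1)^-1 <= (t^-1 ^+ k.+2 / (k.+2)`!%:R)^-1.
  by rewrite lef_pV2 ?posrE ?expR_gt0.
apply: (@le_trans _ _ (t ^- k * (t^-1 ^+ k.+2 / (k.+2)`!%:R)^-1)).
  by rewrite ler_wpM2l// invr_ge0 exprn_ge0// ltW.
rewrite invf_div exprVn invrK -addn2 exprD mulrCA ler_pM2l//.
by rewrite mulrA mulVf ?mul1r// expf_neq0// gt_eqF.
Qed.

Lemma is_derive_flat k t :
  is_derive t 1 (flat k) (flat k.+2 t - k%:R * flat k.+1 t).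
Proof.
have [t0|t0|->] := ltgtP t 0.
- rewrite /flat ltNge (ltW t0)/= mulr0 subr0.
  apply: (@near_eq_is_derive _ _ _ (cst (0 : R))).
  near=> u; have : u < 0 by near: u; exact: lt_nbhsl.
  by move=> u0; rewrite ltNge (ltW u0).
- have D : is_derive t 1 (fun u => u ^- k * expR (- u^-1))
      (flat k.+2 t - k%:R * flat k.+1 t).
    have DV : is_derive t 1 (fun u : R => u^-1) (- t ^- 2).
      apply: DeriveDef; first by apply: derivableV; rewrite ?gt_eqF.
      by rewrite deriveV ?gt_eqF// derive_id /GRing.scale/= mulr1.
    have DN : is_derive t 1 (fun u : R => - u^-1) (t ^- 2).
      rewrite -[t ^- 2]opprK; exact: is_deriveN.
    have DE := @is_derive_comp expR (fun u => - u^-1) _ _ t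
      (is_derive_expR _) DN.
    have -> : (fun u : R => u ^- k * expR (- u^-1)) =
       (fun u : R => u^-1) ^+ k * (fun u : R => expR (- u^-1)).
      by apply/funext => u; rewrite !fctE exprVn.
    apply: is_derive_eq; rewrite /flat t0 /GRing.scale/= !fctE -!exprVn.
    case: k => [|k] /=; rewrite !exprS; ring.
  apply: near_eq_is_derive D.
  near=> u; have u0 : 0 < u by near: u; exact: lt_nbhsr.
  by rewrite /flat u0.
- have f0 j : flat j 0 = 0 by rewrite /flat ltxx.
  rewrite !f0 mulr0 subr0.
  have H : (fun h => h^-1 *: ((flat k \o shift 0) (h *: 1) - flat k 0)) @ 0^'
      --> (0 : R).
    apply/cvgrPdist_le => e e0; near=> h.
    rewrite /= addr0 f0 subr0 sub0r normrN /GRing.scale/= mulr1.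
    rewrite normrM normfV.
    have /andP[p0 le] := flat_le k h.
    rewrite (ger0_norm p0) ler_pdivrMl ?normr_gt0; last first.
      by near: h; exact: nbhs_dnbhs_neq.
    apply: (le_trans le); rewrite -real_normK ?num_real// expr2 mulrA.
    rewrite [leRHS]mulrC ler_wpM2r//.
    rewrite mulrC -ler_pdivlMr ?ltr0n ?fact_gt0//.
    near: h; apply: dnbhs0_le.
    by rewrite divr_gt0// ltr0n fact_gt0.
  apply: DeriveDef; first by apply/cvg_ex; exists 0.
  exact: (cvg_lim _ H).
Unshelve. all: by end_near. Qed.

(** A concrete class of smooth functions. Having a syntax for them makes
    smoothness of all orders a consequence of stability under one derivation. *)
Inductive elementary : (R -> R) -> Prop :=
| elementary_cst c : elementary (fun=> c)
| elementary_id : elementary id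
| elementary_flat k : elementary (flat k)
| elementaryD f g : elementary f -> elementary g ->
    elementary (fun t => f t + g t)
| elementaryM f g : elementary f -> elementary g ->
    elementary (fun t => f t * g t)
| elementaryV f : elementary f -> (forall t, f t != 0) ->
    elementary (fun t => (f t)^-1)
| elementary_affine f c b : elementary f ->
    elementary (fun t => f (c * t + b)).

Lemma elementary_derive f : elementary f ->
  exists2 g, elementary g & forall t, is_derive t 1 f (g t).
Proof.
elim=> {f} [c||k|f g Ef [f' Ef' Df] Eg [g' Eg' Dg]
  |f g Ef [f' Ef' Df] Eg [g' Eg' Dg]|f Ef [f' Ef' Df] f0|f c b Ef [f' Ef' Df]].
- by exists (fun=> 0); [exact: elementary_cst|move=> t; exact: is_derive_cst].
- by exists (fun=> 1); [exact: elementary_cst|move=> t; exact: is_derive_id].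
- exists (fun t => flat k.+2 t + (- k%:R) * flat k.+1 t).
    by apply: elementaryD; [|apply: elementaryM; [exact: elementary_cst|]];
      exact: elementary_flat.
  by move=> t; rewrite mulNr; exact: is_derive_flat.
- exists (fun t => f' t + g' t); first exact: elementaryD.
  by move=> t; exact: is_deriveD.
- exists (fun t => f t * g' t + g t * f' t).
    by apply: elementaryD; exact: elementaryM.
  by move=> t; exact: is_deriveM.
- exists (fun t => (-1 * ((f t)^-1 * (f t)^-1)) * f' t).
    apply: elementaryM => //; apply: elementaryM; first exact: elementary_cst.
    by apply: elementaryM; exact: elementaryV.
  move=> t; have [Dft <-] := Df t.
  apply: DeriveDef; first exact: derivableV.
  by rewrite deriveV// mulN1r expr2 invfM.
- exists (fun t => c * f' (c * t + b)).
    apply: elementaryM; [exact: elementary_cst|exact: elementary_affine].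
  by move=> t; exact: is_derive_affine.
Qed.

Lemma elementary_continuous f : elementary f -> continuous f.
Proof.
move=> /elementary_derive[f' _ Df] t.
by apply: differentiable_continuous; apply/derivable1_diffP; case: (Df t).
Qed.

(** At most four translates are nonzero at a given point. The count is made by
    telescoping. *)
Lemma sum_translates_le f : continuous f ->
  (forall t, ~~ (0 <= t <= 3) -> f t = 0) ->
  exists2 C, 0 < C & forall m s, \sum_(k < m) `|f (s - k%:R)| <= C.
Proof.
move=> cf f0.
have [M M0 fM] : exists2 M, 0 < M & forall t, `|f t| <= M.
  have [//||c _ fc] := @EVT_max R (fun t => `|f t|) 0 3.
    by apply: continuous_subspaceT => t; apply: continuous_comp;
      [exact: cf|exact: norm_continuous].
  exists (`|f c| + 1) => [|t]; first by rewrite ltr_wpDl.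
  have [t03|/f0 ->] := boolP (0 <= t <= 3); last by rewrite normr0 addr_ge0.
  by rewrite (le_trans (fc t _))// lerDl.
(* [G t - G (t - 1)] is the indicator of [0 <= t < 4] *)
pose H (t : R) : R := (0 <= t)%R%:R.
pose G t := H t + H (t - 1) + H (t - 2) + H (t - 3).
have GE t : G t - G (t - 1) = H t - H (t - 4).
  rewrite /G; have -> : t - 1 - 1 = t - 2 by ring.
  have -> : t - 1 - 2 = t - 3 by ring.
  have -> : t - 1 - 3 = t - 4 by ring.
  by ring.
have fG t : `|f t| <= M * (G t - G (t - 1)).
  rewrite GE /H; have [t0|t0] := leP 0 t; last first.
    rewrite (f0 t) ?normr0; last by rewrite negb_and -ltNge t0.
    have -> : (0 <= t - 4) = false by lra.
    by rewrite subr0 mulr0.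
  have [t4|t4] := leP 0 (t - 4); last by rewrite subr0 mulr1.
  rewrite (f0 t) ?normr0 ?subrr ?mulr0//.
  by apply/negP => /andP[_ t3]; lra.
exists (M * 5) => [|m s]; first by rewrite mulr_gt0.
apply: (@le_trans _ _ (\sum_(k < m) M * (G (s - k%:R) - G (s - k.+1%:R)))).
  apply: ler_sum => k _.
  have -> : s - k.+1%:R = s - k%:R - 1 by rewrite -natr1 opprD addrA.
  exact: fG.
rewrite -mulr_sumr ler_wpM2l ?(ltW M0)//.
rewrite (eq_bigr (fun k : 'I_m => - (G (s - k.+1%:R) - G (s - k%:R)))) =>
  [|k _]; last by rewrite opprB.
rewrite sumrN -(big_mkord predT (fun k => G (s - k.+1%:R) - G (s - k%:R))).
rewrite telescope_sumr// opprB subr0.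
have HB t : 0 <= H t <= 1 by rewrite /H; case: (0 <= t); rewrite ?lexx ?ler01.
rewrite /G.
have := HB s; have := HB (s-1); have := HB (s-2); have := HB (s-3).
have := HB (s - m%:R); have := HB (s - m%:R - 1).
have := HB (s - m%:R - 2); have := HB (s - m%:R - 3).
lra.
Qed.

(** The classical step [e t / (e t + e (1 - t))] with [e t = exp (- 1 / t)] for
    [t > 0]. *)
Lemma elementary_step : exists2 S : R -> R, elementary S &
  (forall t, t <= 0 -> S t = 0) /\ (forall t, 1 <= t -> S t = 1).
Proof.
have f0 t : t <= 0 -> flat 0 t = 0 by rewrite /flat ltNge => ->.
have fpos t : 0 < t -> 0 < flat 0 t.
  by move=> t0; rewrite /flat t0 expr0 invr1 mul1r expR_gt0.
have fge0 t : 0 <= flat 0 t by have /andP[] := flat_le 0 t.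
have den t : flat 0 t + flat 0 (-1 * t + 1) != 0.
  rewrite gt_eqF//; have [t0|t0] := ltP 0 t.
    by rewrite ltr_pwDl ?fpos.
  by rewrite ltr_wpDl// fpos//; lra.
exists (fun t => flat 0 t * (flat 0 t + flat 0 (-1 * t + 1))^-1).
  apply: elementaryM; first exact: elementary_flat.
  apply: elementaryV => //; apply: elementaryD; first exact: elementary_flat.
  by apply: elementary_affine; exact: elementary_flat.
split => t ht; first by rewrite f0// mul0r.
rewrite [X in _ + X]f0 ?addr0 ?divff// ?gt_eqF ?fpos//; lra.
Qed.

(** With [T t = t S t], where [S] is a smooth step from [0] to [1], the second
    backward difference of [T] is [beta] and the first backward difference of
    [T'] is [gamma]. Sums of translates telescope, because [T] is [0] for [t <= 0]
    and the identity for [t >= 1]. *)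
Lemma quasi_spline : exists beta gamma : R -> R,
  [/\ elementary beta, elementary gamma,
      forall t, is_derive t 1 beta (gamma t - gamma (t - 1)),
      (forall t, ~~ (0 <= t <= 3) -> beta t = 0 /\ gamma t = 0) &
      forall m s, 3 <= s < m%:R ->
        \sum_(k < m) beta (s - k%:R) = 1 /\ \sum_(k < m) gamma (s - k%:R) = 1].
Proof.
have [S ES [S0 S1]] := elementary_step.
pose T t := t * S t.
have ET : elementary T by apply: elementaryM => //; exact: elementary_id.
have [T' ET' DT] := elementary_derive ET.
have T0 t : t <= 0 -> T t = 0 by move=> t0; rewrite /T S0// mulr0.
have T1 t : 1 <= t -> T t = t by move=> t0; rewrite /T S1// mulr1.
have T'0 t : t < 0 -> T' t = 0.
  move=> t0; have [_ <-] := DT t.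
  rewrite (@near_eq_derive _ _ _ _ (cst (0 : R))) ?derive_cst//.
  near=> u; have : u < 0 by near: u; exact: lt_nbhsl.
  by move=> u0; rewrite T0// ltW.
have T'1 t : 1 < t -> T' t = 1.
  move=> t1; have [_ <-] := DT t.
  rewrite (@near_eq_derive _ _ _ _ id) ?derive_id//.
  near=> u; have : 1 < u by near: u; exact: lt_nbhsr.
  by move=> u0; rewrite T1// ltW.
have sh f (c : R) : elementary f -> elementary (fun t => f (t - c)).
  by move=> /elementary_affine-/(_ 1 (- c)); under eq_fun do rewrite mul1r.
have shD f f' (c t : R) : (forall t, is_derive t 1 f (f' t)) ->
    is_derive t 1 (fun t => f (t - c)) (f' (t - c)).
  move=> Df; have := @is_derive_affine f (f' (t - c)) 1 (- c) t.
  by rewrite !mul1r; under eq_fun do rewrite mul1r; apply; exact: Df.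
have mN f : elementary f -> elementary (fun t => - f t).
  move=> Ef; have := elementaryM (elementary_cst (-1)) Ef.
  by under eq_fun do rewrite mulN1r.
pose tau t := T t - T (t - 1).
pose gamma t := T' t - T' (t - 1).
have Etau : elementary tau by apply: elementaryD => //; exact/mN/sh.
have Egam : elementary gamma by apply: elementaryD => //; exact/mN/sh.
have Dtau t : is_derive t 1 tau (gamma t).
  by apply: is_deriveB; exact: shD.
exists (fun t => tau t - tau (t - 1)), gamma; split => //.
- by apply: elementaryD => //; exact/mN/sh.
- by move=> t; apply: is_deriveB; exact: shD.
- move=> t; rewrite negb_and -!ltNge => /orP[t0|t3]; rewrite /tau /gamma.
    rewrite !T0 ?T'0; lra.
  rewrite !T1 ?T'1; lra.
- have tel (F : R -> R) m s : \sum_(k < m) (F (s - k%:R) - F (s - k%:R - 1)) =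
      F s - F (s - m%:R).
    under eq_bigr => k _ do rewrite -opprB -addrA -opprD natr1.
    rewrite sumrN -(big_mkord predT (fun k => F (s - k.+1%:R) - F (s - k%:R))).
    by rewrite telescope_sumr// opprB subr0.
  move=> m s /andP[s3 sm]; split; rewrite tel.
    rewrite /tau [T s]T1 ?[T (s - 1)]T1 1?[T (s - m%:R)]T0
      1?[T (s - m%:R - 1)]T0; lra.
  rewrite T'1 ?T'0; lra.
Unshelve. all: by end_near. Qed.

End smooth1.

(** * Smooth functions of several variables as sums of tensor products *)

Section coordinates.
Context {R : realType} {n : nat}.
Implicit Types (x y v : 'rV[R]_n) (i j : 'I_n).

Lemma coord_le_norm x i : `|x ord0 i| <= `|x|.
Proof.
rewrite [leRHS]/Num.norm/= mx_normrE.
exact: (le_bigmax _ (fun ij : 'I_1 * 'I_n => `|x ij.1 ij.2|) (ord0, i)).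
Qed.

Lemma norm_le_coord x (e : R) : 0 <= e -> (forall i, `|x ord0 i| <= e) ->
  `|x| <= e.
Proof.
move=> e0 xe; rewrite [leLHS]/Num.norm/= mx_normrE; apply/bigmax_leP.
by split => // -[i j] _ /=; rewrite (ord1 i).
Qed.

Lemma shift_coord x i j (t : R) :
  (t *: delta_mx ord0 j + x) ord0 i = (i == j)%:R * t + x ord0 i.
Proof. by rewrite !mxE eqxx/= mulrC. Qed.

(** Carries the one-variable calculus, and later the mean value theorem, over to
    partial derivatives. *)
Lemma is_derive_line (W : normedModType R) (f : 'rV[R]_n -> W) (g : R -> W)
    x v (c : R) df : (forall t, f (t *: v + x) = g (t + c)) ->
  is_derive x v f df <-> is_derive c 1 g df.
Proof.
move=> fg.
have E : (fun h => h^-1 *: ((f \o shift x) (h *: v) - f x)) =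
         (fun h => h^-1 *: ((g \o shift c) (h *: 1) - g c)).
  apply/funext => h /=; rewrite fg [h%:A]mulr1.
  by have := fg 0; rewrite scale0r !add0r => ->.
by split=> -[]; rewrite /derivable /derive -?E ?{1}E => D <-; apply: DeriveDef;
  rewrite /derivable /derive ?E.
Qed.

End coordinates.

Section tensor.
Context {R : realType} {n : nat}.
Implicit Types (f g : 'rV[R]_n -> R) (x : 'rV[R]_n).

(** Tensor products suffice for the interpolants below, and they are stable under
    partial derivatives since the factors are differentiated one at a time. *)
Inductive tensor : ('rV[R]_n -> R) -> Prop :=
| tensor_prod b : (forall i, elementary (b i)) ->
    tensor (fun x => \prod_(i < n) b i (x ord0 i))
| tensorD f g : tensor f -> tensor g -> tensor (fun x => f x + g x)
| tensorZ c f : tensor f -> tensor (fun x => c * f x).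

Lemma is_derive_prod (b : 'I_n -> R -> R) j db x :
  is_derive (x ord0 j) 1 (b j) db ->
  is_derive x (delta_mx ord0 j) (fun x => \prod_(i < n) b i (x ord0 i))
    (db * \prod_(i < n | i != j) b i (x ord0 i)).
Proof.
move=> D.
apply/(@is_derive_line _ _ _ _
  (fun t => b j t * \prod_(i < n | i != j) b i (x ord0 i)) _ _ (x ord0 j)).
  move=> t; rewrite (bigD1 j)//= shift_coord eqxx mul1r; congr (_ * _).
  apply: eq_bigr => i /negbTE ij.
  by rewrite shift_coord ij mul0r add0r.
have -> : (fun t => b j t * \prod_(i < n | i != j) b i (x ord0 i)) =
    b j * cst (\prod_(i < n | i != j) b i (x ord0 i)) by [].
by apply: is_derive_eq; rewrite scaler0 add0r [RHS]mulrC.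
Qed.

Lemma tensor_partial f j : tensor f -> tensor (partial j f) /\
  forall x, derivable f x (delta_mx ord0 j).
Proof.
elim=> {f} [b Eb|f g _ [tf df] _ [tg dg]|c f _ [tf df]].
- have [b' Eb' Db] := elementary_derive (Eb j).
  have D x := @is_derive_prod b j _ x (Db (x ord0 j)).
  split => [|x]; last by case: (D x).
  pose b2 i := if i == j then b' else b i.
  have -> : partial j (fun x => \prod_(i < n) b i (x ord0 i)) =
      fun x => \prod_(i < n) b2 i (x ord0 i).
    apply/funext => x; rewrite /partial; have [_ ->] := D x.
    rewrite [RHS](bigD1 j)//= /b2 eqxx; congr (_ * _).
    by apply: eq_bigr => i /negbTE ->.
  by apply: tensor_prod => i; rewrite /b2; case: ifP.
- split => [|x]; last exact: derivableD.
  have -> : partial j (fun x => f x + g x) =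
      fun x => partial j f x + partial j g x.
    by apply/funext => x; rewrite /partial deriveD.
  exact: tensorD.
- split => [|x]; last exact: derivableZ.
  have -> : partial j (fun x => c * f x) = fun x => c * partial j f x.
    by apply/funext => x; rewrite /partial (@deriveZ _ _ _ f).
  exact: tensorZ.
Qed.

Lemma tensor_continuous f : tensor f -> continuous f.
Proof.
elim=> {f} [b Eb|f g _ cf _ cg|c f _ cf] x.
- apply: continuous_big => [|i _ y]; first exact: mul_continuous.
  apply: (@continuous_comp _ _ _ (fun x : 'rV[R]_n => x ord0 i)).
    exact: coord_continuous.
  exact: elementary_continuous.
- by apply: continuousD; [exact: cf|exact: cg].
- by apply: continuousM; [exact: cst_continuous|exact: cf].
Qed.

Lemma tensor_Ck f k : tensor f -> Ck_on k setT f.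
Proof.
move=> tf s x _.
have ts : tensor (partials s f).
  by elim: s => [|i s IH] //=; case: (tensor_partial i IH).
split=> _ => [i|]; first by case: (tensor_partial i ts).
exact: tensor_continuous.
Qed.

End tensor.

(** * Quasi-interpolation on a grid *)

Section interpolation.
Context {R : realType} {n : nat}.
Implicit Types (x y : 'rV[R]_n) (f : 'rV[R]_n -> R) (b : 'I_n -> R -> R).

(** What the convergence proofs use of [beta] and [gamma]. The translates are
    summed over [0 <= k < m] instead of over all integers, whence the restriction
    to points [s] that are far enough from both ends. *)
Definition unity_kernel (C : R) (b : R -> R) : Prop :=
  [/\ forall t, ~~ (0 <= t <= 3) -> b t = 0,
      forall m s, 3 <= s < m%:R -> \sum_(k < m) b (s - k%:R) = 1 &
      forall m s, \sum_(k < m) `|b (s - k%:R)| <= C].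

(** The grid is the part of [h Z^n] in the cube of half-side [h N]; it is indexed
    by [0 <= k_i < 2 N], so that the indices form a finite type. *)
Definition node (h : R) (N : nat) (k : {ffun 'I_n -> 'I_(N + N)}) : 'rV[R]_n :=
  \row_i (h * ((k i)%:R - N%:R)).

Definition weight b h N (k : {ffun 'I_n -> 'I_(N + N)}) x : R :=
  \prod_(i < n) b i (h^-1 * x ord0 i + N%:R - (k i)%:R).

(** The one-dimensional kernel may depend on the coordinate, so that partial
    derivatives of interpolants are again interpolants. *)
Definition interp b h N f x : R :=
  \sum_(k : {ffun 'I_n -> 'I_(N + N)}) f (node h k) * weight b h k x.

(** The points of the cube around which no grid point is missing. *)
Definition inner (h : R) (N : nat) x : Prop :=
  forall i, 3 <= h^-1 * x ord0 i + N%:R < (N + N)%:R.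

Lemma weight_sum C b h N x : (forall i, unity_kernel C (b i)) -> inner h N x ->
  \sum_(k : {ffun 'I_n -> 'I_(N + N)}) weight b h k x = 1.
Proof.
move=> kb ix.
rewrite -(bigA_distr_bigA (fun i (j : 'I_(N + N)) =>
  b i (h^-1 * x ord0 i + N%:R - j%:R))).
by apply: big1 => i _; have [_ + _] := kb i; apply.
Qed.

Lemma weight_sum_norm C b h N x : (forall i, unity_kernel C (b i)) ->
  \sum_(k : {ffun 'I_n -> 'I_(N + N)}) `|weight b h k x| <= C ^+ n.
Proof.
move=> kb; under eq_bigr => k _ do rewrite normr_prod.
rewrite -(bigA_distr_bigA (fun i (j : 'I_(N + N)) =>
  `|b i (h^-1 * x ord0 i + N%:R - j%:R)|)).
rewrite -[X in _ <= _ ^+ X]card_ord -prodr_const.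
apply: ler_prod => i _; rewrite sumr_ge0//=.
by have [_ _] := kb i; apply.
Qed.

Lemma weight_neq0 C b h N (k : {ffun 'I_n -> 'I_(N + N)}) x : 0 < h ->
  (forall i, unity_kernel C (b i)) -> weight b h k x != 0 ->
  `|x - node h k| <= 3 * h.
Proof.
move=> h0 kb; rewrite /weight => /prodf_neq0 w0.
apply: norm_le_coord => [|i]; first by rewrite mulr_ge0// ltW.
have /contraNT-/(_ (w0 i isT)) :
    ~~ (0 <= h^-1 * x ord0 i + N%:R - (k i)%:R <= 3) ->
    b i (h^-1 * x ord0 i + N%:R - (k i)%:R) == 0.
  by have [+ _ _] := kb i => /[apply] ->.
have -> : h^-1 * x ord0 i + N%:R - (k i)%:R = h^-1 * (x - node h k) ord0 i.
  rewrite !mxE mulrBr mulrA mulVf ?gt_eqF// mul1r; ring.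
rewrite ler_pdivlMl// mulr0 ler_pdivrMl// [h * 3]mulrC => /andP[p0 p1].
by rewrite ger0_norm.
Qed.

Lemma interp_bounded C b h N f x B : (forall i, unity_kernel C (b i)) ->
  (forall y, `|f y| <= B) -> `|interp b h N f x| <= B * C ^+ n.
Proof.
move=> kb fB; apply: (le_trans (ler_norm_sum _ _ _)).
have B0 : 0 <= B by rewrite (le_trans _ (fB 0)).
apply: (@le_trans _ _
    (B * \sum_(k : {ffun 'I_n -> 'I_(N + N)}) `|weight b h k x|)).
  by rewrite mulr_sumr; apply: ler_sum => k _; rewrite normrM ler_wpM2r.
by rewrite ler_wpM2l//; exact: weight_sum_norm.
Qed.

(** The weights sum to [1], so that the interpolant deviates from [c] by an
    average of the deviations of [f] at the nodes close to [x]. *)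
Lemma interp_near C b h N f x c e : 0 < h -> (forall i, unity_kernel C (b i)) ->
  inner h N x -> 0 <= e -> (forall y, `|x - y| <= 3 * h -> `|f y - c| <= e) ->
  `|interp b h N f x - c| <= e * C ^+ n.
Proof.
move=> h0 kb ix e0 fe.
rewrite -[c]mulr1 -(weight_sum kb ix) mulr_sumr /interp -sumrB.
apply: (le_trans (ler_norm_sum _ _ _)).
apply: (@le_trans _ _
    (e * \sum_(k : {ffun 'I_n -> 'I_(N + N)}) `|weight b h k x|)).
  rewrite mulr_sumr; apply: ler_sum => k _; rewrite -mulrBl normrM.
  have [->|w0] := eqVneq (weight b h k x) 0; first by rewrite normr0 !mulr0.
  by rewrite ler_wpM2r// fe// (weight_neq0 h0 kb).
by rewrite ler_wpM2l//; exact: weight_sum_norm.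
Qed.

Lemma interp_neq0 C b h N f x : 0 < h -> (forall i, unity_kernel C (b i)) ->
  interp b h N f x != 0 ->
  exists2 k : {ffun 'I_n -> 'I_(N + N)},
    f (node h k) != 0 & `|x - node h k| <= 3 * h.
Proof.
move=> h0 kb Pf0; apply: contrapT => /forall2NP nk.
move/eqP: Pf0; apply; apply: big1 => k _.
have [/negP/negPn/eqP ->|/negP wk] := nk k; first by rewrite mul0r.
apply/eqP; rewrite mulf_eq0; apply/orP; right; apply: contraNT wk.
exact: weight_neq0.
Qed.

Lemma tensor_sum (I : Type) (r : seq I) (F : I -> 'rV[R]_n -> R) :
  (forall k, tensor (F k)) -> tensor (fun x => \sum_(k <- r) F k x).
Proof.
move=> tF; elim: r => [|k r IH].
  have T0 := tensorZ 0 (tensor_prod (fun i : 'I_n => @elementary_cst R 0)).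
  by apply: (eq_ind _ tensor T0); apply/funext => x; rewrite big_nil mul0r.
under eq_fun do rewrite big_cons; exact: tensorD.
Qed.

Lemma tensor_interp b h N f : (forall i, elementary (b i)) ->
  tensor (interp b h N f).
Proof.
move=> eb; apply: tensor_sum => k; apply: tensorZ.
apply: (eq_ind _ tensor (tensor_prod
  (fun i => elementary_affine h^-1 (N%:R - (k i)%:R) (eb i)))).
by apply/funext => x; apply: eq_bigr => i _; rewrite addrA.
Qed.

(** The support of the interpolant lies in a finite union of closed balls of
    radius [3 h] around the nodes at which [f] does not vanish. *)
Lemma interp_Cinfty_c C b h N f (V : set 'rV[R]_n) : 0 < h ->
  (forall i, unity_kernel C (b i)) -> (forall i, elementary (b i)) ->
  (forall y, f y != 0 -> forall z, `|y - z| <= 3 * h -> V z) ->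
  Cinfty_c V (interp b h N f).
Proof.
move=> h0 kb eb fV k.
pose D := \bigcup_(k in [set k : {ffun 'I_n -> 'I_(N + N)} | f (node h k) != 0])
  closed_ball (node h k) (3 * h).
have h3 : 0 < 3 * h by rewrite mulr_gt0.
have sD : [set x | interp b h N f x != 0] `<=` D.
  move=> x /(interp_neq0 h0 kb)[l fl xl]; exists l => //.
  by rewrite closed_ballE// /closed_ball_/= distrC.
have cD : compact D.
  rewrite /D -bigsetU_fset_set//; last exact: finite_finset.
  apply: bigsetU_compact => l _.
  apply: bounded_closed_compact; last exact: closed_ball_closed.
  exists (`|node h l| + 3 * h); split => [|r Mr y]; first exact: num_real.
  rewrite closed_ballE// /closed_ball_/= => ly; apply: le_trans (ltW Mr).
  by rewrite -lerBlDl (le_trans (lerB_dist _ _))// distrC.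
have scD : closure [set x | interp b h N f x != 0] `<=` D.
  rewrite (closure_id D).1; first exact: closure_subset.
  by apply: compact_closed => //; exact: norm_hausdorff.
split.
- by move=> s x _; apply: (tensor_Ck _ (tensor_interp _ _ _ eb)).
- by apply: (subclosed_compact _ cD) => //; exact: closed_closure.
- move=> x /scD[l /= fl]; rewrite closed_ballE// /closed_ball_/=.
  exact: fV.
Qed.

Lemma is_derive_bigsum (I : Type) (r : seq I) (F : I -> 'rV[R]_n -> R)
    (dF : I -> R) x v : (forall k, is_derive x v (F k) (dF k)) ->
  is_derive x v (fun x => \sum_(k <- r) F k x) (\sum_(k <- r) dF k).
Proof.
move=> DF; elim: r => [|k r IH].
  under eq_fun do rewrite big_nil; rewrite big_nil; exact: is_derive_cst.
under eq_fun do rewrite big_cons; rewrite big_cons; exact: is_deriveD.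
Qed.

(** Summation by parts in the [j]-th index. The hypothesis on the support of [f]
    makes the boundary terms vanish, so the shift of the index may be taken
    cyclically, which turns it into a permutation of the finite grid. *)
Lemma interp_partial (beta gamma : R -> R) (h : R) N f j x : 0 < h ->
  (forall t : R, is_derive t 1 beta (gamma t - gamma (t - 1))) ->
  (forall y, f y != 0 -> forall i, `|y ord0 i| < h * (N%:R - 1)) ->
  partial j (interp (fun=> beta) h N f) x =
  interp (fun i => if i == j then gamma else beta) h N
    (fun y => h^-1 * (f y - f (y - h *: delta_mx ord0 j))) x.
Proof.
move=> h0 Db f0.
pose c := h^-1 * x ord0 j + N%:R.
pose rest (k : {ffun 'I_n -> 'I_(N + N)}) :=
  \prod_(i < n | i != j) beta (h^-1 * x ord0 i + N%:R - (k i)%:R).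
have Dw (k : {ffun 'I_n -> 'I_(N + N)}) :
    is_derive x (delta_mx ord0 j) (weight (fun=> beta) h k)
      (h^-1 * (gamma (c - (k j)%:R) - gamma (c - (k j)%:R - 1)) * rest k).
  apply: (@is_derive_prod _ _
    (fun i t => beta (h^-1 * t + N%:R - (k i)%:R)) j _ x).
  have := @is_derive_affine _ beta _ h^-1 (N%:R - (k j)%:R) (x ord0 j) (Db _).
  rewrite addrA; under eq_fun do rewrite addrA; exact.
have D : is_derive x (delta_mx ord0 j) (interp (fun=> beta) h N f)
    (\sum_(k : {ffun 'I_n -> 'I_(N + N)}) f (node h k) *
      (h^-1 * (gamma (c - (k j)%:R) - gamma (c - (k j)%:R - 1)) * rest k)).
  apply: is_derive_bigsum => k; exact: is_deriveZ.
rewrite /partial; have [_ ->] := D => {D Dw}.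
pose sh (k : {ffun 'I_n -> 'I_(N + N)}) : {ffun 'I_n -> 'I_(N + N)} :=
  [ffun i => if i == j then ordS (k i) else k i].
pose sh' (k : {ffun 'I_n -> 'I_(N + N)}) : {ffun 'I_n -> 'I_(N + N)} :=
  [ffun i => if i == j then ord_pred (k i) else k i].
have shK : cancel sh sh'.
  by move=> k; apply/ffunP => i; rewrite !ffunE; case: (i == j); rewrite ?ordSK.
have sh'K : cancel sh' sh.
  move=> k; apply/ffunP => i; rewrite !ffunE.
  by case: (i == j); rewrite ?ord_predK.
have rest_sh k : rest (sh k) = rest k.
  by apply: eq_bigr => i /negbTE ij; rewrite ffunE ij.
have wE k : weight (fun i => if i == j then gamma else beta) h k x =
    gamma (c - (k j)%:R) * rest k.
  rewrite /weight (bigD1 j)//= eqxx; congr (_ * _).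
  by apply: eq_bigr => i /negbTE ->.
have E : \sum_k f (node h k) * (gamma (c - (k j)%:R - 1) * rest k) =
    \sum_k f (node h k - h *: delta_mx ord0 j) *
      (gamma (c - (k j)%:R) * rest k).
  rewrite [RHS](reindex sh) /=; last by exists sh' => k _.
  apply: eq_bigr => k _; rewrite rest_sh ffunE eqxx.
  have [kN|kN] := ltnP (k j).+1 (N + N).
    have vS : (ordS (k j) : nat) = (k j).+1 by rewrite /= modn_small.
    congr (f _ * (gamma _ * _)); last by rewrite vS -natr1 opprD addrA.
    apply/rowP => i; rewrite !mxE ffunE; have [->|ij] := eqVneq i j.
      by rewrite vS -natr1 /=; ring.
    by rewrite mulr0 subr0.
  have kE : (k j).+1 = (N + N)%N by apply/eqP; rewrite eqn_leq kN ltn_ord.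
  have vS : (ordS (k j) : nat) = 0%N by rewrite /= kE modnn.
  have kR : (k j)%:R = N%:R + N%:R - 1 :> R.
    have /(congr1 (fun m => m%:R : R)) := kE.
    by rewrite natrD -natr1 => <-; rewrite addrK.
  have N1 : 1 <= N%:R :> R.
    rewrite ler1n -(ltr0n R).
    by have : 0 <= (k j)%:R :> R := ler0n _ _; rewrite kR; lra.
  have [->|/f0/(_ j)] := eqVneq (f (node h k)) 0; last first.
    rewrite mxE kR normrM gtr0_norm// ltr_pM2l// ger0_norm; lra.
  have [->|/f0/(_ j)] := eqVneq (f (node h (sh k) - h *: delta_mx ord0 j)) 0.
    by rewrite !mul0r.
  rewrite !mxE ffunE !eqxx vS /= mulr1 sub0r -[X in _ - X]mulr1 -mulrBr.
  rewrite normrM gtr0_norm//.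
  rewrite ltr_pM2l// ler0_norm; lra.
rewrite /interp.
transitivity (h^-1 * (\sum_k f (node h k) * (gamma (c - (k j)%:R) * rest k) -
   \sum_k f (node h k) * (gamma (c - (k j)%:R - 1) * rest k))).
  by rewrite -sumrB mulr_sumr; apply: eq_bigr => k _; ring.
rewrite E -sumrB mulr_sumr; apply: eq_bigr => k _; rewrite wE; ring.
Qed.

End interpolation.

(** * C^1 functions with compact support *)

Lemma near_eq_continuous (T U : topologicalType) (f g : T -> U) x :
  (\forall y \near x, f y = g y) -> {for x, continuous f} ->
  {for x, continuous g}.
Proof.
move=> fg; rewrite /prop_for /continuous_at -(nbhs_singleton fg).
by apply: cvg_trans; exact: near_eq_cvg.
Qed.

Section C1.
Context {R : realType} {n : nat}.
Implicit Types (x y : 'rV[R]_n) (f g : 'rV[R]_n -> R) (V : set 'rV[R]_n).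

Lemma Ck_c_eq0 (W : normedModType R) k V (g : 'rV[R]_n -> W) x :
  Ck_c k V g -> ~ V x -> g x = 0.
Proof.
move=> [_ _ gV] nVx; apply: contrapT => /eqP gx; apply: nVx; apply: gV.
exact: subset_closure.
Qed.

Lemma near_compl_support (W : normedModType R) (g : 'rV[R]_n -> W) x :
  ~ closure [set x | g x != 0] x -> \forall y \near x, g y = 0.
Proof.
move=> nx; have : nbhs x (~` closure [set x | g x != 0]).
  by apply: open_nbhs_nbhs; split => //; exact/closed_openC/closed_closure.
apply: filterS => y ny; apply: contrapT => /eqP gy; apply: ny.
exact: subset_closure.
Qed.

Lemma partial_compl_support (g : 'rV[R]_n -> R) i x :
  ~ closure [set x | g x != 0] x ->
  derivable g x (delta_mx ord0 i) /\ partial i g x = 0.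
Proof.
move=> /near_compl_support g0.
have g0' : \forall y \near x, cst 0 y = g y.
  by apply: filterS g0 => y ->.
have [? ?] := near_eq_is_derive g0' (is_derive_cst (0 : R) x (delta_mx ord0 i)).
by [].
Qed.

(** Derivatives of all orders vanish off the support. This is what allows a test
    function to be seen as one on a larger set, or on the whole space. *)
Lemma partials_compl_support s (g : 'rV[R]_n -> R) x :
  ~ closure [set x | g x != 0] x ->
  [/\ partials s g x = 0, {for x, continuous (partials s g)} &
      forall i, derivable (partials s g) x (delta_mx ord0 i)].
Proof.
have zero y : ~ closure [set x | g x != 0] y ->
    \forall z \near y, partials s g z = 0.
  elim: s y => [|i s IH] y; first exact: near_compl_support.
  move=> ny; have oC : open (~` closure [set x | g x != 0]).
    exact/closed_openC/closed_closure.
  apply: filterS (open_nbhs_nbhs (conj oC ny)) => z /IH gz.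
  by rewrite /= /partial (near_eq_derive (g := cst 0)) ?derive_cst.
move=> /zero gx; split.
- exact: nbhs_singleton gx.
- exact: (near_cst_continuous 0) gx.
- move=> i; apply: (near_eq_derivable (f := cst (0 : R))).
    by apply: filterS gx => y ->.
  exact: derivable_cst.
Qed.

Lemma Ck_c_sub k (U V : set 'rV[R]_n) g : U `<=` V -> Ck_c k U g -> Ck_c k V g.
Proof.
move=> UV [Cg cg gU]; split => //; last exact: subset_trans gU UV.
move=> s x _; have [/gU/Cg//|nx] := pselect (closure [set x | g x != 0] x).
by have [_ ? ?] := partials_compl_support s nx.
Qed.

(** Having continuous partial derivatives on the whole space; for a test function
    extended by zero this carries no reference to an open set. *)
Definition C1 g : Prop := continuous g /\ forall i, continuous (partial i g) /\
  forall x, derivable g x (delta_mx ord0 i).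

Lemma Ck_c_C1 V g : Ck_c 1 V g -> C1 g.
Proof.
move=> [Cg _ gV].
have [in_V out_V] : (forall x, closure [set x | g x != 0] x -> V x) /\
    forall x, ~ closure [set x | g x != 0] x ->
      \forall y \near x, ~ closure [set x | g x != 0] y.
  split => // x nx; apply: open_nbhs_nbhs; split => //.
  exact/closed_openC/closed_closure.
split=> [x|i]; [|split=> x].
- have [/in_V Vx|nx] := pselect (closure [set x | g x != 0] x).
    by have [_ /(_ isT)] := Cg [::] x Vx.
  have g0 := near_compl_support nx.
  exact: (near_cst_continuous 0) g0.
- have [/in_V Vx|nx] := pselect (closure [set x | g x != 0] x).
    by have [_ /(_ isT)] := Cg [:: i] x Vx.
  apply: (near_cst_continuous (0 : R)).
  by apply: filterS (out_V x nx) => y /(partial_compl_support i)[].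
- have [/in_V Vx|nx] := pselect (closure [set x | g x != 0] x).
    by have [/(_ isT)/(_ i)] := Cg [::] x Vx.
  by have [] := partial_compl_support i nx.
Qed.

Lemma bounded_compact_support f (K : set 'rV[R]_n) : continuous f ->
  compact K -> (forall x, ~ K x -> f x = 0) ->
  exists B : R, forall x, `|f x| <= B.
Proof.
move=> cf cK f0.
have [[x Kx]|K0] := pselect (exists x, K x); last first.
  by exists 0 => x; rewrite f0 ?normr0// => Kx; apply: K0; exists x.
have Kn0 : K !=set0 by exists x.
have [|c _ fc] := @EVT_max_rV R n (fun x => `|f x|) K Kn0 cK.
  apply: continuous_subspaceT => y; apply: continuous_comp; first exact: cf.
  exact: norm_continuous.
exists `|f c| => y; have [Ky|nKy] := pselect (K y); last by rewrite f0// normr0.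
by apply: fc; rewrite inE.
Qed.

(** The mean value theorem, for the difference quotient that appears in
    [interp_partial]. *)
Lemma partial_mvt f j y (h : R) : 0 < h ->
  (forall x, derivable f x (delta_mx ord0 j)) ->
  exists2 z, `|y - z| <= h &
    h^-1 * (f y - f (y - h *: delta_mx ord0 j)) = partial j f z.
Proof.
move=> h0 df; pose y0 := y - h *: delta_mx ord0 j.
pose g (t : R) := f (t *: delta_mx ord0 j + y0).
have Dg (t : R) : is_derive t 1 g (partial j f (t *: delta_mx ord0 j + y0)).
  apply/(@is_derive_line _ _ _ f g (t *: delta_mx ord0 j + y0)
    (delta_mx ord0 j)); last exact: derivableP.
  by move=> u; rewrite /g scalerDl addrA.
have [|t th gE] := @MVT_segment R g _ 0 h (ltW h0) (fun t _ => Dg t).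
  by apply: derivable_within_continuous => t _; case: (Dg t).
have {gE} : f y - f y0 = partial j f (t *: delta_mx ord0 j + y0) * h.
  have yE : h *: delta_mx ord0 j + y0 = y by rewrite addrC subrK.
  by move: gE; rewrite /g scale0r add0r subr0 yE.
move=> ->; exists (t *: delta_mx ord0 j + y0); last first.
  by rewrite mulrCA mulVf ?mulr1// gt_eqF.
move: th; rewrite in_itv/= => /andP[t0 th].
apply: norm_le_coord => [|i]; first exact: ltW.
rewrite !mxE eqxx /=; case: (i == j).
  by rewrite !mulr1 ger0_norm; lra.
by rewrite !mulr0 add0r !subr0 subrr normr0 ltW.
Qed.

End C1.

(** * Smooth approximation *)

Lemma spline_kernels (R : realType) : exists (C : R) (beta gamma : R -> R),
  [/\ 0 < C, elementary beta, elementary gamma,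
      unity_kernel C beta /\ unity_kernel C gamma &
      forall t : R, is_derive t 1 beta (gamma t - gamma (t - 1))].
Proof.
have [beta [gamma [Eb Eg Db supp sum1]]] := @quasi_spline R.
have [C1 C10 le1] := sum_translates_le (elementary_continuous Eb)
  (fun t ht => (supp t ht).1).
have [C2 C20 le2] := sum_translates_le (elementary_continuous Eg)
  (fun t ht => (supp t ht).2).
exists (C1 + C2), beta, gamma; split => //; first exact: addr_gt0.
split; split => [t /supp[]//|m s /sum1[]//|m s].
- by rewrite (le_trans (le1 m s))// lerDl ltW.
- by rewrite (le_trans (le2 m s))// lerDr ltW.
Qed.

Section approximation.
Context {R : realType} {n : nat}.
Implicit Types (x y z : 'rV[R]_n) (f g : 'rV[R]_n -> R) (V K : set 'rV[R]_n).

Definition mesh (p : nat) : R := p.+1%:R^-1.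

(** With mesh [1 / (p + 1)] this size makes the half-side of the cube [p + 1], so
    that every point is eventually well inside the grid. *)
Definition gridsize (p : nat) : nat := (p.+1 * p.+1)%N.

Lemma mesh_gt0 p : 0 < mesh p. Proof. by rewrite invr_gt0. Qed.

Lemma near_mesh (c e : R) : 0 < e -> \forall p \near \oo, c * mesh p < e.
Proof.
move=> e0; near=> p.
have : c / e < p.+1%:R.
  rewrite -natr1 (@le_lt_trans _ _ p%:R) ?ltrDl//.
  by near: p; exact: nbhs_infty_ger.
by rewrite /mesh ltr_pdivrMr// ltr_pdivrMr// mulrC.
Unshelve. all: by end_near. Qed.

Lemma near_inner x : \forall p \near \oo, inner (mesh p) (gridsize p) x.
Proof.
near=> p; move=> i.
have xp : `|x| + 3 <= p%:R by near: p; exact: nbhs_infty_ger.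
have := coord_le_norm x i; rewrite ler_norml => /andP[xi1 xi2].
have x0 := normr_ge0 x.
have p3 : 3 <= p%:R :> R by lra.
rewrite /mesh /gridsize invrK natrD !natrM -!natr1.
nra.
Unshelve. all: by end_near. Qed.

Lemma near_ball V x (c : R) : open V -> V x ->
  \forall p \near \oo, forall z, `|x - z| <= c * mesh p -> V z.
Proof.
move=> oV Vx; have : nbhs x V by exact: open_nbhs_nbhs.
move=> /nbhs_ballP[e /= e0 eV]; near=> p; move=> z xz; apply: eV.
rewrite -ball_normE/= (le_lt_trans xz)//; near: p; exact: near_mesh.
Unshelve. all: by end_near. Qed.

(** A compact subset of an open set has a positive margin in it; the covering
    form of compactness gives the uniformity directly. *)
Lemma near_compact_margin K V (c : R) : compact K -> open V -> K `<=` V ->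
  \forall p \near \oo, forall y, K y -> forall z, `|y - z| <= c * mesh p -> V z.
Proof.
move=> /compact_near_coveringP cK oV KV.
apply: (cK nat \oo
  (fun p y => forall z, `|y - z| <= c * mesh p -> V z)) => x Kx.
have : nbhs x V by apply: open_nbhs_nbhs; split => //; exact: KV.
move=> /nbhs_ballP[e /= e0 eV].
have e2 : 0 < e / 2 by rewrite divr_gt0.
exists (ball x (e / 2), [set p | c * mesh p < e / 2]).
  by split; [exact: nbhsx_ballx|exact: near_mesh].
move=> [y p] [/= xy pe] z yz; apply: eV; move: xy; rewrite -!ball_normE/= => xy.
rewrite (le_lt_trans (ler_distD y _ _))// (splitr e) ltrD//.
exact: le_lt_trans yz pe.
Qed.

(** The interpolated function is the indicator of the points at distance more than
    [3 h] from the complement of [V]. This keeps the supports in [V], and near a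
    point of [V] all nodes eventually carry the value [1]. *)
Lemma open_indicator_approx V : open V ->
  exists (g : nat -> 'rV[R]_n -> R) (B : R),
    [/\ forall p, Cinfty_c V (g p), forall p x, `|g p x| <= B,
        forall x, V x -> (fun p => g p x) @ \oo --> (1 : R) &
        forall p x, ~ V x -> g p x = 0].
Proof.
move=> oV; have [C [beta [_ [C0 Eb _ [kb _] _]]]] := spline_kernels R.
(* an interpolant only sees nodes at distance at most [3 h] *)
pose Vp p := [set y | forall z, `|y - z| <= 3 * mesh p -> V z].
pose f p x : R := (x \in Vp p)%:R.
pose g p := interp (fun=> beta) (mesh p) (gridsize p) (f p).
have gV p : Cinfty_c V (g p).
  apply: (@interp_Cinfty_c _ _ C (fun=> beta) _ _ _ _ (mesh_gt0 p)) => // y.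
  by rewrite /f; case: (boolP (y \in Vp p)) => [/set_mem//|_]; rewrite eqxx.
exists g, (1 * C ^+ n); split => // [p x|x Vx|p x nVx].
- apply: (@interp_bounded _ _ C (fun=> beta)) => // y.
  by rewrite /f; case: (y \in Vp p); rewrite ?normr1 ?normr0.
- apply: cvg_near_cst; near=> p.
  apply/eqP; rewrite -subr_eq0 -normr_le0 -(mul0r (C ^+ n)).
  apply: (@interp_near _ _ C (fun=> beta) _ _ _ _ _ _ (mesh_gt0 p)) => // [|y xy].
    by near: p; exact: near_inner.
  rewrite /f mem_set ?subrr ?normr0// => z yz.
  suff : forall z, `|x - z| <= 6 * mesh p -> V z.
    apply; rewrite (le_trans (ler_distD y _ _))//.
    have -> : 6 * mesh p = 3 * mesh p + 3 * mesh p by ring.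
    exact: lerD.
  by near: p; exact: near_ball.
- exact: Ck_c_eq0 (gV p 0%N) nVx.
Unshelve. all: by end_near. Qed.

(** Interpolation of a C^1 function converges together with its first
    derivatives. Pointwise convergence and a uniform bound are easier to get than
    uniform convergence and are enough under an integral. *)
Lemma Ck_c1_smooth_approx V f j : Ck_c 1 V f -> open V ->
  exists (g : nat -> 'rV[R]_n -> R) (B : R),
    [/\ forall p, Cinfty_c V (g p),
        forall p x, `|g p x| <= B,
        forall p x, `|partial j (g p) x| <= B,
        forall x, (fun p => g p x) @ \oo --> f x &
        forall x, (fun p => partial j (g p) x) @ \oo --> partial j f x].
Proof.
move=> Cf oV; have [C [beta [gamma [C0 Eb Eg [kb kg] Db]]]] := spline_kernels R.
have [_ cptf fV] := Cf.
set K := closure _ in cptf fV.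
have [cf /(_ j)[cdf df]] := Ck_c_C1 Cf.
have f0 x : ~ K x -> f x = 0.
  by move=> nKx; exact: nbhs_singleton (near_compl_support nKx).
have df0 x : ~ K x -> partial j f x = 0.
  by move=> /(partial_compl_support j)[].
have [B1 fB] := bounded_compact_support cf cptf f0.
have [B2 dfB] := bounded_compact_support cdf cptf df0.
pose k i := if i == j then gamma else beta.
have kk i : unity_kernel C (k i) by rewrite /k; case: ifP.
pose D p y := (mesh p)^-1 * (f y - f (y - mesh p *: delta_mx ord0 j)).
have DE p y : exists2 z, `|y - z| <= mesh p & D p y = partial j f z.
  exact: partial_mvt (mesh_gt0 p) df.
pose g p := interp (fun=> beta) (mesh p) (gridsize p) f.
(* the support of [f] is bounded, so the boundary terms eventually vanish *)
have near_dg : \forall p \near \oo, forall x,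
    partial j (g p) x = interp k (mesh p) (gridsize p) (D p) x.
  have [M [_ /(_ (M + 1)) KM]] := compact_bounded cptf.
  have {}KM y : f y != 0 -> `|y| <= M + 1.
    move=> fy; apply: KM; first by rewrite ltrDl.
    exact: subset_closure.
  near=> p; move=> x.
  have Mp : M + 1 < p%:R by near: p; exact: nbhs_infty_gtr.
  apply: interp_partial => //; first exact: mesh_gt0.
  move=> y /KM yM i; rewrite (le_lt_trans (coord_le_norm y i))//.
  rewrite (le_lt_trans yM)// (lt_le_trans Mp)//.
  rewrite /mesh ler_pdivlMl// /gridsize natrM -natr1; have := ler0n R p; nra.
have near_V : \forall p \near \oo, Cinfty_c V (g p).
  near=> p.
  apply: (@interp_Cinfty_c _ _ C (fun=> beta) _ _ _ _ (mesh_gt0 p)) => // y fy.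
  suff : forall y, K y -> forall z, `|y - z| <= 3 * mesh p -> V z.
    by apply; exact: subset_closure.
  by near: p; exact: near_compact_margin.
have unif (u : 'rV[R]_n -> R) x (c e : R) : {for x, continuous u} -> 0 < e ->
    \forall p \near \oo, forall z, `|x - z| <= c * mesh p -> `|u z - u x| <= e.
  move=> /cvgrPdist_le cu e0.
  have /nbhs_ballP[r /= r0 rU] := cu e e0.
  near=> p; move=> z xz; rewrite distrC; apply: rU.
  rewrite -ball_normE/= (le_lt_trans xz)//; near: p; exact: near_mesh.
have cvg_g x : (fun p => g p x) @ \oo --> f x.
  apply/cvgrPdist_le => e e0.
  have e'0 : 0 < e / C ^+ n by rewrite divr_gt0// exprn_gt0.
  near=> p; rewrite distrC -[e](@divfK _ (C ^+ n)) ?gt_eqF ?exprn_gt0//.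
  apply: (@interp_near _ _ C (fun=> beta) _ _ _ _ _ _ (mesh_gt0 p)) => //.
  - by near: p; exact: near_inner.
  - exact: ltW.
  - by near: p; apply: unif => //; exact: cf.
have cvg_dg x : (fun p => partial j (g p) x) @ \oo --> partial j f x.
  apply/cvgrPdist_le => e e0.
  have e'0 : 0 < e / C ^+ n by rewrite divr_gt0// exprn_gt0.
  near=> p; rewrite distrC -[e](@divfK _ (C ^+ n)) ?gt_eqF ?exprn_gt0//.
  have -> : partial j (g p) x = interp k (mesh p) (gridsize p) (D p) x.
    near: p; apply: filterS near_dg => p; exact.
  apply: (@interp_near _ _ C k _ _ _ _ _ _ (mesh_gt0 p)) => //.
  - by near: p; exact: near_inner.
  - exact: ltW.
  - move=> y xy; have [z yz ->] := DE p y.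
    have : `|x - z| <= 4 * mesh p.
      rewrite (le_trans (ler_distD y _ _))//.
      have -> : 4 * mesh p = 3 * mesh p + mesh p by ring.
      exact: lerD.
    suff : forall z, `|x - z| <= 4 * mesh p ->
        `|partial j f z - partial j f x| <= e / C ^+ n by apply.
    by near: p; apply: unif => //; exact: cdf.
(* dropping finitely many terms makes the eventual properties hold throughout *)
have [p0 _ Hp0] : \forall p \near \oo, Cinfty_c V (g p) /\ forall x,
    partial j (g p) x = interp k (mesh p) (gridsize p) (D p) x.
  by near=> p; split; near: p.
exists (fun p => g (p + p0)%N), ((B1 + B2) * C ^+ n).
have H p : (p0 <= p + p0)%N by exact: leq_addl.
have B10 := le_trans (normr_ge0 _) (fB 0).
have B20 := le_trans (normr_ge0 _) (dfB 0).
split=> [p|p x|p x|x|x].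
- by have [] := Hp0 _ (H p).
- apply: (@interp_bounded _ _ C (fun=> beta)) => // y.
  by rewrite (le_trans (fB y))// lerDl.
- have [_ ->] := Hp0 _ (H p); apply: (@interp_bounded _ _ C k) => // y.
  have [z _ ->] := DE (p + p0)%N y.
  by rewrite (le_trans (dfB z))// lerDr.
- by have := cvg_g x; rewrite -(cvg_shiftn p0).
- by have := cvg_dg x; rewrite -(cvg_shiftn p0).
Unshelve. all: by end_near. Qed.

End approximation.

(** * Density of a linear class of functions in a weighted L^1 space *)

Section weighted_approximation.
Context d (T : measurableType d) (R : realType).
Variables (mu : {measure set T -> \bar R}) (D : set T).
Implicit Types (f u v w : T -> R).

Definition bounded_measurable u : Prop :=
  measurable_fun D u /\ exists B : R, forall x, D x -> `|u x| <= B.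

Lemma bounded_measurableD u v : bounded_measurable u -> bounded_measurable v ->
  bounded_measurable (fun x => u x + v x).
Proof.
move=> [mu_ [B1 uB]] [mv [B2 vB]]; split; first exact: measurable_funD.
exists (B1 + B2) => x Dx.
by rewrite (le_trans (ler_normD _ _))// lerD ?uB ?vB.
Qed.

Lemma bounded_measurableZ c u : bounded_measurable u ->
  bounded_measurable (fun x => c * u x).
Proof.
move=> [mu_ [B uB]]; split; first by apply: measurable_funM.
by exists (`|c| * B) => x Dx; rewrite normrM ler_wpM2l ?uB.
Qed.

Lemma bounded_measurableB u v : bounded_measurable u -> bounded_measurable v ->
  bounded_measurable (fun x => u x - v x).
Proof.
move=> bu /(bounded_measurableZ (-1)) /(bounded_measurableD bu).
by under eq_fun do rewrite mulN1r.
Qed.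

Lemma bounded_measurable_norm u : bounded_measurable u ->
  bounded_measurable (fun x => `|u x|).
Proof.
move=> [mu_ [B uB]]; split; first exact: measurableT_comp.
by exists B => x Dx; rewrite normr_id uB.
Qed.

Hypothesis mD : measurable D.

Lemma integrable_mul_bounded f u : mu.-integrable D (EFin \o f) ->
  bounded_measurable u -> mu.-integrable D (EFin \o (fun x => f x * u x)).
Proof.
move=> fi [mu_ [B uB]]; apply: (integrableMl mD fi mu_).
exists B; split => [|r Br x Dx]; first exact: num_real.
exact: le_trans (uB x Dx) (ltW Br).
Qed.

(** Dominated convergence, for a fixed integrable factor. *)
Lemma cvg_integral_mul f (u_ : nat -> T -> R) u (B : R) :
  mu.-integrable D (EFin \o f) -> (forall p, measurable_fun D (u_ p)) ->
  (forall p x, D x -> `|u_ p x| <= B) ->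
  (forall x, D x -> (fun p => u_ p x) @ \oo --> u x) ->
  measurable_fun D u ->
  (fun p => \int[mu]_(x in D) (f x * u_ p x)%:E)%E @ \oo -->
    (\int[mu]_(x in D) (f x * u x)%:E)%E.
Proof.
move=> fi mu_ uB uu mu0.
have mf : measurable_fun D f.
  by apply/measurable_EFinP; exact: measurable_int fi.
have Bf : mu.-integrable D (EFin \o (fun x => `|f x| * B)).
  apply: (@integrable_mul_bounded (fun x => `|f x|) (fun=> B)).
    exact: (integrable_abse fi).
  by split => //; exists `|B|.
have [] // := @dominated_convergence _ _ _ mu D mD
  (fun p x => (f x * u_ p x)%:E) (fun x => (f x * u x)%:E)
  (fun x => (`|f x| * B)%:E).
- by move=> p; apply/measurable_EFinP; exact: measurable_funM.
- by apply/measurable_EFinP; exact: measurable_funM.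
- apply: aeW => x Dx; apply: cvg_EFin; first exact: nearW.
  by apply: cvgM; [exact: cvg_cst|exact: uu].
- apply: aeW => x p Dx /=; rewrite lee_fin normrM ler_wpM2l//; exact: uB.
Qed.

Variable w : T -> R.
Hypothesis wi : mu.-integrable D (EFin \o w).

Definition seminorm_w u : \bar R := (\int[mu]_(x in D) (`|w x| * `|u x|)%:E)%E.

Lemma seminorm_w_le u v1 v2 : bounded_measurable u ->
  bounded_measurable v1 -> bounded_measurable v2 ->
  (forall x, D x -> `|u x| <= `|v1 x| + `|v2 x|) ->
  (seminorm_w u <= seminorm_w v1 + seminorm_w v2)%E.
Proof.
move=> bu bv1 bv2 uv.
have wi' : mu.-integrable D (EFin \o (fun x => `|w x|)).
  exact: (integrable_abse wi).
have I u' : bounded_measurable u' ->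
    mu.-integrable D (EFin \o (fun x => `|w x| * `|u' x|)).
  move=> bu'; apply: integrable_mul_bounded => //.
  exact: bounded_measurable_norm.
rewrite /seminorm_w -integralD//; [|exact: I|exact: I].
apply: le_integral => //; [exact: I|apply: integrableD => //; exact: I|].
move=> x /set_mem Dx; rewrite -EFinD lee_fin -mulrDr ler_wpM2l//.
exact: uv.
Qed.

Lemma seminorm_w_cvg (u_ : nat -> T -> R) u (B : R) :
  (forall p, measurable_fun D (u_ p)) ->
  (forall p x, D x -> `|u_ p x| <= B) ->
  (forall x, D x -> (fun p => u_ p x) @ \oo --> u x) ->
  bounded_measurable u ->
  (fun p => seminorm_w (fun x => u x - u_ p x)) @ \oo --> 0%E.
Proof.
move=> mu_ uB uu [mu0 [B' uB']].
have := @cvg_integral_mul (fun x => `|w x|) (fun p x => `|u x - u_ p x|)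
  (fun=> 0) (B' + B) (integrable_abse wi).
under [X in _ -> _ -> _ -> _ -> _ --> X]eq_integral do rewrite mulr0.
rewrite integral0; apply.
- by move=> p; apply: measurableT_comp => //; exact: measurable_funB.
- move=> p x Dx; rewrite normr_id (le_trans (ler_normB _ _))// lerD//.
    exact: uB'.
  exact: uB.
- move=> x Dx; rewrite -[X in _ --> X](normr0 R) -[X in `|X|](subrr (u x)).
  by apply: cvg_norm; apply: cvgB; [exact: cvg_cst|exact: uu].
- exact: measurable_cst.
Qed.

Variable A : set (T -> R).
Hypothesis A_bm : forall g, A g -> bounded_measurable g.
Hypothesis A_lin : forall c g h, A g -> A h -> A (fun x => c * g x + h x).

Definition approximable u : Prop := bounded_measurable u /\
  forall e : R, 0 < e -> exists2 g, A g &
    (seminorm_w (fun x => (u x - g x)%R) < e%:E)%E.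

Lemma approximable_lin c u v : approximable u -> approximable v ->
  approximable (fun x => c * u x + v x).
Proof.
move=> [bu au] [bv av]; split.
  by apply: bounded_measurableD => //; exact: bounded_measurableZ.
move=> e e0; have c0 : 0 < `|c| + 1 by rewrite ltr_wpDl.
have e1 : 0 < e / 2 / (`|c| + 1) by rewrite !divr_gt0.
have [g Ag ug] := au _ e1.
have e2 : 0 < e / 2 by rewrite divr_gt0.
have [h Ah vh] := av _ e2.
exists (fun x => c * g x + h x); first exact: A_lin.
have bg := A_bm Ag; have bh := A_bm Ah.
have bug := bounded_measurableB bu bg.
apply: (@le_lt_trans _ _ (seminorm_w (fun x => c * (u x - g x))%R +
    seminorm_w (fun x => v x - h x)%R)%E).
  apply: seminorm_w_le.
  - apply: bounded_measurableB; apply: bounded_measurableD => //;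
      exact: bounded_measurableZ.
  - exact: bounded_measurableZ.
  - exact: bounded_measurableB.
  - move=> x Dx; apply: le_trans (ler_normD _ _).
    by rewrite le_eqVlt; apply/orP; left; apply/eqP; congr `|_|; ring.
rewrite (splitr e) EFinD; apply: lteD => //.
have -> : seminorm_w (fun x => c * (u x - g x)) =
    (`|c|%:E * seminorm_w (fun x => (u x - g x)%R))%E.
  rewrite /seminorm_w -ge0_integralZl//.
  - by apply: eq_integral => x _; rewrite -EFinM normrM mulrCA.
  - apply/measurable_EFinP; apply: measurable_funM.
      apply: measurableT_comp => //.
      by apply/measurable_EFinP; exact: measurable_int wi.
    by apply: measurableT_comp => //; case: bug.
apply: (@le_lt_trans _ _ (`|c|%:E * (e / 2 / (`|c| + 1))%:E)%E).
  by rewrite lee_wpmul2l// ltW.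
rewrite -EFinM lte_fin mulrA ltr_pdivrMr//.
by rewrite [ltLHS]mulrC ltr_pM2l// ltrDl.
Qed.

(** Bounded pointwise limits are limits in the weighted L^1 space, so
    approximability passes to them. *)
Lemma approximable_cvg (u_ : nat -> T -> R) u (B : R) :
  (forall p, approximable (u_ p)) ->
  (forall p x, D x -> `|u_ p x| <= B) ->
  (forall x, D x -> (fun p => u_ p x) @ \oo --> u x) ->
  bounded_measurable u -> approximable u.
Proof.
move=> au uB uu bu; split => // e e0.
have e2 : 0 < e / 2 by rewrite divr_gt0.
have := seminorm_w_cvg (fun p => (au p).1.1) uB uu bu.
move=> /fine_cvgP[fin_s /cvgrPdist_lt/(_ _ e2)].
move=> /(filterI fin_s)[p _ /(_ p (leqnn p))[/= finp]].
rewrite sub0r normrN => sp.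
have [g Ag ug] := (au p).2 _ e2.
exists g => //.
apply: (@le_lt_trans _ _ (seminorm_w (fun x => (u x - u_ p x)%R) +
    seminorm_w (fun x => (u_ p x - g x)%R))%E).
  have bp := (au p).1; have bg := A_bm Ag.
  apply: seminorm_w_le; [exact: bounded_measurableB..|].
  by move=> x Dx; exact: ler_distD.
rewrite (splitr e) EFinD; apply: lteD => //.
rewrite -(fineK finp) lte_fin; apply: le_lt_trans sp; exact: ler_norm.
Qed.

Lemma approximable_mem g : A g -> approximable g.
Proof.
move=> Ag; split; first exact: A_bm.
move=> e e0; exists g => //; rewrite /seminorm_w.
under eq_integral do rewrite subrr normr0 mulr0.
by rewrite integral0 lte_fin.
Qed.

Variable G : set (set T).
Hypothesis GT : G setT.
Hypothesis GI : setI_closed G.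
Hypothesis G_generates : d.-measurable = <<s G>>.
Hypothesis G_cvg : forall U, G U -> exists (g : nat -> T -> R) (B : R),
  [/\ forall p, A (g p), forall p x, D x -> `|g p x| <= B &
      forall x, D x -> (fun p => g p x) @ \oo --> (\1_U x : R)].

Lemma norm_indic_le1 (U : set T) x : `|\1_U x| <= 1 :> R.
Proof. by rewrite indicE; case: (x \in U); rewrite ?normr1 ?normr0. Qed.

Lemma bounded_measurable_indic U : measurable U ->
  bounded_measurable (\1_U : T -> R).
Proof.
move=> mU; split; first by apply: measurable_funTS; exact: measurable_indic.
by exists 1 => x _; exact: norm_indic_le1.
Qed.

(** The sets with approximable indicator form a lambda-system, because the
    approximable functions are stable under differences and bounded pointwise
    limits; the pi-lambda theorem concludes. *)
Lemma approximable_indic U : measurable U -> approximable (\1_U : T -> R).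
Proof.
pose H := [set V | measurable V /\ approximable (\1_V : T -> R)].
have GH : G `<=` H.
  move=> V GV; have mV : measurable V.
    by rewrite G_generates; exact: sub_sigma_algebra.
  split => //; have [g [B [Ag gB gV]]] := G_cvg GV.
  apply: (approximable_cvg (u_ := g)) gB gV _ => [p|].
    exact: approximable_mem.
  exact: bounded_measurable_indic.
have LH : lambda_system setT H.
  split => //; first exact: GH.
  - move=> V W WV [mV aV] [mW aW]; split; first exact: measurableD.
    have -> : (\1_(V `\` W) : T -> R) = fun x => -1 * \1_W x + \1_V x.
      apply/funext => x; rewrite !indicE in_setD.
      have [xW|xW] := boolP (x \in W); last by rewrite andbT mulr0 add0r.
      by rewrite andbF mem_set ?mulr1 ?addNr//; apply: WV; exact: set_mem.
    exact: approximable_lin.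
  - move=> F ndF HF; have mF i : measurable (F i) by case: (HF i).
    split; first exact: bigcupT_measurable.
    apply: (approximable_cvg (u_ := fun p => \1_(F p)) (B := 1)) => //.
    + by move=> p; case: (HF p).
    + by move=> p x _; exact: norm_indic_le1.
    + move=> x Dx; have [[i _ Fix]|nF] := pselect ((\bigcup_i F i) x).
        apply: cvg_near_cst; exists i => // j /= ij.
        rewrite !indicE !mem_set//; first by exists i.
        by move: Fix; apply/subsetPset/ndF.
      rewrite (_ : (fun p => \1_(F p) x) = cst 0).
        by rewrite indicE memNset//; exact: cvg_cst.
      apply/funext => p; rewrite indicE memNset// => Fpx; apply: nF.
      by exists p.
    + by apply: bounded_measurable_indic; exact: bigcupT_measurable.
by rewrite G_generates => /(lambda_system_subset GI LH GH (fun _ _ _ _ => I))[].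
Qed.

Import HBSimple HBNNSimple.

(** A translate of [u] by a constant is nonnegative, hence a bounded limit of
    simple functions. *)
Lemma approximable_bounded_measurable u : bounded_measurable u ->
  approximable u.
Proof.
move=> bu; have [mu_ [B uB]] := bu.
have a1 : approximable (\1_setT : T -> R) by exact: approximable_indic.
have a0 : approximable (fun=> 0 : R).
  have := approximable_lin (-1) a1 a1.
  by under eq_fun do rewrite mulN1r addNr.
(* [u + B] is nonnegative, as the approximation by simple functions requires *)
pose v x := (u x + B)%:E.
have v0 x : D x -> (0 <= v x)%E.
  move=> /uB; rewrite ler_norml lee_fin => /andP[+ _].
  by rewrite -[0 <= _]lerBlDr sub0r.
have mv : measurable_fun D v.
  by apply/measurable_EFinP; exact: measurable_funD.
pose s := nnsfun_approx mD mv.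
have asp p : approximable (s p : T -> R).
  have [r E] : exists r : seq R, (s p : T -> R) =
      fun x => \sum_(y <- r) (y * \1_(s p @^-1` [set y]) x).
    exists (finmap.enum_fset (fset_set (range (s p)))).
    by apply/funext => x; rewrite fimfunE fsbig_finite//; exact: fimfunP.
  rewrite E; elim: r {E} => [|y r IH].
    by under eq_fun do rewrite big_nil.
  under eq_fun do rewrite big_cons; apply: approximable_lin => //.
  exact: approximable_indic.
have av : approximable (fun x => u x + B).
  apply: (approximable_cvg (u_ := s) (B := B + B)) => //.
  - move=> p x Dx; rewrite ger0_norm// -lee_fin /s nnsfun_approxE.
    apply: (le_trans (le_approx _ v0 Dx)); rewrite lee_fin lerD2r.
    by rewrite (le_trans (ler_norm _))// uB.
  - move=> x Dx; have := cvg_nnsfun_approx mD mv v0 Dx.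
    by move=> /fine_cvgP[].
  - split; first exact: measurable_funD.
    exists (B + B) => x Dx; rewrite (le_trans (ler_normD _ _))//.
    have B0 : 0 <= B := le_trans (normr_ge0 _) (uB x Dx).
    by rewrite (ger0_norm B0) lerD2r uB.
have := approximable_lin (- B) a1 av.
under eq_fun do rewrite indicE in_setT mulr1 addrCA addNr addr0.
exact.
Qed.

End weighted_approximation.

(** * Algebra of C^1 functions and vector fields *)

Lemma continuous_row (R : realType) (n : nat) (T : topologicalType)
    (u : 'I_n -> T -> R) : (forall j, continuous (u j)) ->
  continuous (fun x => \row_j u j x : 'rV[R]_n).
Proof.
move=> cu x; apply/cvgrPdist_le => e e0; near=> y.
apply: norm_le_coord => [|j]; first exact: ltW.
rewrite !mxE; move: j; near: y; apply: filter_forall => j.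
by have /cvgrPdist_le := cu j x; exact.
Unshelve. all: by end_near. Qed.

Section C1_algebra.
Context {R : realType} {n : nat}.
Implicit Types (x y : 'rV[R]_n) (f g : 'rV[R]_n -> R) (V : set 'rV[R]_n).

Lemma C1_cst c : C1 (fun _ : 'rV[R]_n => c).
Proof.
have E i : partial i (fun _ : 'rV[R]_n => c) = fun=> 0.
  by apply/funext => x; exact: derive_cst.
split=> [|i]; first by move=> x; exact: cst_continuous.
rewrite E; split=> x; [exact: cst_continuous|exact: derivable_cst].
Qed.

Lemma C1D f g : C1 f -> C1 g -> C1 (fun x => f x + g x).
Proof.
move=> [cf df] [cg dg]; split=> [x|i].
  by apply: continuousD; [exact: cf|exact: cg].
have [cdf ddf] := df i; have [cdg ddg] := dg i.
have -> : partial i (fun x => f x + g x) =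
    fun x => partial i f x + partial i g x.
  by apply/funext => x; exact: deriveD.
by split=> x; [apply: continuousD; [exact: cdf|exact: cdg]|exact: derivableD].
Qed.

Lemma C1M f g : C1 f -> C1 g -> C1 (fun x => f x * g x).
Proof.
move=> [cf df] [cg dg]; split=> [x|i].
  by apply: continuousM; [exact: cf|exact: cg].
have [cdf ddf] := df i; have [cdg ddg] := dg i.
have -> : partial i (fun x => f x * g x) =
    fun x => f x * partial i g x + g x * partial i f x.
  by apply/funext => x; exact: deriveM.
split=> x; last exact: derivableM.
by apply: (@continuousD _ _ _ (fun x => f x * partial i g x)
    (fun x => g x * partial i f x)); apply: continuousM;
  [exact: cf|exact: cdg|exact: cg|exact: cdf].
Qed.

Lemma C1V g : C1 g -> (forall x, g x != 0) -> C1 (fun x => (g x)^-1).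
Proof.
move=> [cg dg] g0; split=> [x|i].
  by apply: continuousV; [exact: g0|exact: cg].
have [cdg ddg] := dg i.
have -> : partial i (fun x => (g x)^-1) =
    fun x => - (g x)^-1 * (g x)^-1 * partial i g x.
  apply/funext => x; rewrite /partial deriveV//.
  by rewrite expr2 invfM mulNr.
have cV : continuous (fun x => (g x)^-1).
  by move=> x; apply: continuousV; [exact: g0|exact: cg].
split=> x; last by apply: derivableV => //; exact: ddg.
apply: (@continuousM _ _ (fun x => - (g x)^-1 * (g x)^-1)); last exact: cdg.
apply: (@continuousM _ _ (fun x => - (g x)^-1)); last exact: cV.
by apply: (@continuousN _ _ _ (fun x => (g x)^-1)); exact: cV.
Qed.

Lemma C1_sum (I : Type) (r : seq I) (F : I -> 'rV[R]_n -> R) :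
  (forall k, C1 (F k)) -> C1 (fun x => \sum_(k <- r) F k x).
Proof.
move=> CF; elim: r => [|k r IH].
  by under eq_fun do rewrite big_nil; exact: C1_cst.
by under eq_fun do rewrite big_cons; exact: C1D.
Qed.

Lemma C1_Ck_c g (K V : set 'rV[R]_n) : C1 g -> compact K -> K `<=` V ->
  (forall x, ~ K x -> g x = 0) -> Ck_c 1 V g.
Proof.
move=> [cg dg] cK KV g0.
have sK : closure [set x | g x != 0] `<=` K.
  rewrite (closure_id K).1; last by apply: compact_closed => //; exact: norm_hausdorff.
  apply: closure_subset => x /= gx; apply: contrapT => /g0 gx0.
  by rewrite gx0 eqxx in gx.
split.
- move=> s x _; split=> [|]; case: s => [|i [|j s]]//= _.
  + by move=> i; case: (dg i).
  + exact: cg.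
  + by case: (dg i) => + _; exact.
- by apply: (subclosed_compact _ cK) => //; exact: closed_closure.
- exact: subset_trans sK KV.
Qed.

Lemma Ck_c1_lin V c f g : Ck_c 1 V f -> Ck_c 1 V g ->
  Ck_c 1 V (fun x => c * f x + g x).
Proof.
move=> Cf Cg; have [_ cf fV] := Cf; have [_ cg gV] := Cg.
apply: (C1_Ck_c
  (K := closure [set x | f x != 0] `|` closure [set x | g x != 0])).
- apply: C1D; last exact: Ck_c_C1 Cg.
  by apply: C1M; [exact: C1_cst|exact: Ck_c_C1 Cf].
- exact: compactU.
- by move=> x [/fV|/gV].
- move=> x /not_orP[nf ng].
  have -> : f x = 0 := nbhs_singleton (near_compl_support nf).
  have -> : g x = 0 := nbhs_singleton (near_compl_support ng).
  by rewrite mulr0 addr0.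
Qed.

(** The partial derivatives of a coordinate agree with those of the field on the
    open set [V] only, but continuity is a local property. *)
Lemma Ck_c1_coord V (phi : 'rV[R]_n -> 'rV[R]_n) : open V -> Ck_c 1 V phi ->
  forall j, Ck_c 1 V (fun x => phi x ord0 j).
Proof.
move=> oV [Cphi cphi phiV] j.
have cE : continuous (fun M : 'rV[R]_n => M ord0 j) by exact: coord_continuous.
have sE : closure [set x | phi x ord0 j != 0] `<=` closure [set x | phi x != 0].
  apply: closure_subset => x /=; apply: contraNN => /eqP ->.
  by rewrite mxE.
have DE i x : V x -> derivable (fun x => phi x ord0 j) x (delta_mx ord0 i) /\
    partial i phi x ord0 j = partial i (fun x => phi x ord0 j) x.
  move=> Vx; have [/(_ isT)/(_ i) d _] := Cphi [::] x Vx.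
  split; first exact: (derivable_mxP _ _ _).1.
  by rewrite /partial derive_mx// mxE.
split.
- move=> s x Vx; split; case: s => [|i [|k s]]//= _.
  + by move=> i; have [] := DE i x Vx.
  + have [_ /(_ isT) c] := Cphi [::] x Vx.
    by apply: (@continuous_comp _ _ _ phi (fun M : 'rV[R]_n => M ord0 j)) => //;
      exact: cE.
  + have [_ /(_ isT) c] := Cphi [:: i] x Vx.
    have : {for x, continuous (fun x => partial i phi x ord0 j)}.
      by apply: (@continuous_comp _ _ _ (partial i phi)
        (fun M : 'rV[R]_n => M ord0 j)) => //; exact: cE.
    apply: near_eq_continuous; near=> y; apply: (DE i y _).2.
    by near: y; exact: open_nbhs_nbhs.
- by apply: (subclosed_compact _ cphi) => //; exact: closed_closure.
- exact: subset_trans sE phiV.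
Unshelve. all: by end_near. Qed.

Lemma Ck_c1_row V (g : 'I_n -> 'rV[R]_n -> R) : (forall j, Ck_c 1 V (g j)) ->
  Ck_c 1 V (fun x => \row_j g j x).
Proof.
move=> Cg.
have CgE j := Ck_c_C1 (Cg j).
have dE i x : derivable (fun x => \row_j g j x : 'rV[R]_n) x (delta_mx ord0 i).
  apply/derivable_mxP => k j; under eq_fun do rewrite mxE.
  by have [_ /(_ i)[_ d]] := CgE j; exact: d.
have pE i : partial i (fun x => \row_j g j x : 'rV[R]_n) =
    fun x => \row_j partial i (g j) x.
  apply/funext => x; rewrite /partial derive_mx//.
  by apply/rowP => j; rewrite !mxE; under eq_fun do rewrite mxE.
pose K := \bigcup_(j in [set: 'I_n]) closure [set x | g j x != 0].
have cK : compact K.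
  rewrite /K -bigsetU_fset_set//; last exact: finite_finset.
  by apply: bigsetU_compact => j _; case: (Cg j).
have sK : closure [set x | (\row_j g j x : 'rV[R]_n) != 0] `<=` K.
  rewrite (closure_id K).1; last by apply: compact_closed => //; exact: norm_hausdorff.
  apply: closure_subset => x /= gx; apply: contrapT => nK.
  move/eqP: gx; apply; apply/rowP => j; rewrite !mxE.
  by apply: (nbhs_singleton (near_compl_support _)) => gj; apply: nK; exists j.
split.
- move=> s x _; split; case: s => [|i [|k s]]//= _.
  + by apply: continuous_row => j; case: (CgE j).
  + by rewrite pE; apply: continuous_row => j; have [_ /(_ i)[]] := CgE j.
- by apply: (subclosed_compact _ cK) => //; exact: closed_closure.
- by move=> x /sK[j _]; case: (Cg j) => _ _; exact.
Unshelve. all: by end_near. Qed.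

End C1_algebra.

(** * Two inequalities in Euclidean space *)

Section pointwise.
Context {R : realType} {d : nat}.
Implicit Types (G g u phi : 'I_d -> R).

Lemma sum_sqr_eq0 G : \sum_j G j ^+ 2 = 0 -> forall j, G j = 0.
Proof.
move=> /eqP; rewrite psumr_eq0 => [/allP h j|i _]; last exact: sqr_ge0.
by apply/eqP; rewrite -sqrf_eq0; exact: h j (mem_index_enum j).
Qed.

(** Cauchy-Schwarz for a vector in the unit ball, from
    [- 2 G_j phi_j <= G_j^2 / w + w phi_j^2]. *)
Lemma dot_le_norm G phi (w : R) : 0 <= w -> w ^+ 2 = \sum_j G j ^+ 2 ->
  \sum_j phi j ^+ 2 <= 1 -> - \sum_j G j * phi j <= w.
Proof.
move=> w0 wE phi1; have [w00|wn0] := eqVneq w 0.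
  have G0 : forall j, G j = 0 by apply: sum_sqr_eq0; rewrite -wE w00 expr0n.
  by rewrite big1 ?oppr0// => j _; rewrite G0 mul0r.
have wp : 0 < w by rewrite lt_def wn0.
apply: (@le_trans _ _ (\sum_j (G j ^+ 2 / w + w * phi j ^+ 2) / 2)).
  rewrite -sumrN; apply: ler_sum => j _.
  rewrite ler_pdivlMr// -subr_ge0.
  have -> : G j ^+ 2 / w + w * phi j ^+ 2 - - (G j * phi j) * 2 =
      (G j + w * phi j) ^+ 2 / w by field.
  by rewrite divr_ge0// sqr_ge0.
rewrite -mulr_suml big_split/= -mulr_suml -mulr_sumr -wE expr2 mulfK//.
rewrite ler_pdivrMr// mulr_natr mulr2n lerD2l.
by rewrite -[leRHS]mulr1 ler_wpM2l.
Qed.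

(** Here [w = |G|] and [u = - G / w] is a unit vector unless [G = 0]. The claim
    comes from [1 - 2 u . g / N = |u - g|^2 / N], with [N = 1 + |g|^2], and from
    [|u_j - g_j| <= 1 + |g_j| <= 2 N]. *)
Lemma norm_le_dot G g (w : R) : 0 <= w -> w ^+ 2 = \sum_j G j ^+ 2 ->
  w <= - (\sum_j G j * (2 * g j * (1 + \sum_i g i * g i)^-1)) +
    2 * \sum_j w * `|- (G j / w) - g j|.
Proof.
move=> w0 wE; have [w00|wn0] := eqVneq w 0.
  have G0 : forall j, G j = 0 by apply: sum_sqr_eq0; rewrite -wE w00 expr0n.
  rewrite big1 => [|j _]; last by rewrite G0 mul0r.
  by rewrite oppr0 add0r w00 mulr_ge0// sumr_ge0// => j _; rewrite mul0r.
have wp : 0 < w by rewrite lt_def wn0.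
pose u j := - (G j / w).
set N := 1 + \sum_i g i * g i.
have g2 j : g j ^+ 2 <= N - 1.
  rewrite /N addrC addKr (bigD1 j)//= expr2 lerDl sumr_ge0// => i _.
  by rewrite -expr2 sqr_ge0.
have N1 : 1 <= N by rewrite lerDl sumr_ge0// => i _; rewrite -expr2 sqr_ge0.
have N0 : 0 < N by rewrite (lt_le_trans ltr01).
have u2 : \sum_j u j ^+ 2 = 1.
  under eq_bigr do rewrite sqrrN exprMn exprVn.
  by rewrite -mulr_suml -wE divff// sqrf_eq0.
have key : 1 - \sum_j u j * (2 * g j * N^-1) = (\sum_j (u j - g j) ^+ 2) / N.
  have -> : \sum_j (u j - g j) ^+ 2 = N - \sum_j u j * (2 * g j).
    have -> : N = \sum_j u j ^+ 2 + \sum_j g j * g j by rewrite u2.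
    by rewrite -big_split/= -sumrB; apply: eq_bigr => j _; ring.
  rewrite mulrBl divff ?gt_eqF// mulr_suml; congr (_ - _).
  by apply: eq_bigr => j _; rewrite mulrA.
have le : 1 - \sum_j u j * (2 * g j * N^-1) <= 2 * \sum_j `|u j - g j|.
  rewrite key ler_pdivrMr// mulrAC mulr_sumr.
  apply: ler_sum => j _; rewrite -real_normK ?num_real// expr2 ler_wpM2r//.
  have uj : `|u j| <= 1.
    rewrite -(@ler_pXn2r _ 2)// ?nnegrE// expr1n real_normK ?num_real//.
    rewrite -u2 (bigD1 j)//= lerDl sumr_ge0// => i _; exact: sqr_ge0.
  rewrite (le_trans (ler_normB _ _))//.
  have := g2 j; rewrite -real_normK ?num_real//.
  by move: (`|g j|) => t ht; nra.
have -> : \sum_j G j * (2 * g j * N^-1) = - w * \sum_j u j * (2 * g j * N^-1).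
  rewrite mulr_sumr; apply: eq_bigr => j _; rewrite [RHS]mulrA; congr (_ * _).
  by rewrite /u mulrN mulNr opprK mulrC divfK.
rewrite -mulr_sumr mulNr opprK -lerBlDl -[X in X - _]mulr1 -mulrBr.
by rewrite mulrCA ler_pM2l.
Qed.

(** [4 q <= (1 + q)^2]. *)
Lemma normalised_field_le1 g :
  \sum_j (2 * g j * (1 + \sum_i g i * g i)^-1) ^+ 2 <= 1.
Proof.
set q := \sum_i g i * g i.
have q0 : 0 <= q by rewrite sumr_ge0// => i _; rewrite -expr2 sqr_ge0.
have -> : \sum_j (2 * g j * (1 + q)^-1) ^+ 2 = 4 * q / (1 + q) ^+ 2.
  rewrite /q mulr_sumr mulr_suml; apply: eq_bigr => j _.
  by rewrite !exprMn exprVn expr2 -natrM -expr2 mulrA.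
rewrite ler_pdivrMr ?mul1r ?exprn_gt0 ?ltr_pwDl//.
have := sqr_ge0 (1 - q); nra.
Qed.

End pointwise.

(** * The operator A_minus on C^1 test functions *)

Lemma open_continuous_measurable_rV (R : realType) (n : nat)
    (V : set 'rV[R]_n) (u : 'rV[R]_n -> R) : open V ->
  (forall x, V x -> {for x, continuous u}) -> measurable_fun V u.
Proof.
move=> oV cu; apply: (measurability _ (RGenOpens.measurableE R)).
move=> _ [_ [a [b ->]] <-]; apply: open_measurable_rV.
rewrite openE => x [Vx uab]; apply: filterI; first exact: open_nbhs_nbhs.
have nab : nbhs (u x) `]a, b[%classic.
  by apply: open_nbhs_nbhs; split => //; exact: interval_open.
exact: (cu x Vx _ nab).
Qed.

Lemma compact_measurable_rV (R : realType) (n : nat) (K : set 'rV[R]_n) :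
  compact K -> measurable K.
Proof.
move=> cK; have clK : closed K.
  by apply: compact_closed => //; exact: norm_hausdorff.
rewrite -[K]setCK; apply: measurableC; apply: open_measurable_rV.
exact: closed_openC.
Qed.

Lemma bounded_measurable_compact_support (R : realType) (n : nat)
    (Omega K : set 'rV[R]_n) (g : 'rV[R]_n -> R) :
measurable Omega -> continuous g ->
  compact K -> (forall x, ~ K x -> g x = 0) -> bounded_measurable Omega g.
Proof.
move=> mO cg cK g0; split; last first.
  by have [B gB] := bounded_compact_support cg cK g0; exists B.
apply: measurable_funTS.
apply: open_continuous_measurable_rV; first exact: openT.
by move=> x _; exact: cg.
Qed.

Section A_minus.
Context {R : realType} {d : nat} (a : R).
Implicit Types (x y : 'rV[R]_d) (psi : 'rV[R]_d -> R) (V : set 'rV[R]_d).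
Local Notation mu := (lebesgue_rV d).

Lemma enorm_sqr x : enorm x ^+ 2 = \sum_j x ord0 j ^+ 2.
Proof. by rewrite sqr_sqrtr// sumr_ge0// => i _; exact: sqr_ge0. Qed.

Lemma enorm_ge0 x : 0 <= enorm x. Proof. exact: sqrtr_ge0. Qed.

Lemma enorm_eq0 x : enorm x = 0 -> x = 0.
Proof.
move=> x0; apply/rowP => j; rewrite mxE.
by apply: (sum_sqr_eq0 (G := fun i => x ord0 i)); rewrite -enorm_sqr x0 expr0n.
Qed.

Lemma drift_continuous j x : x <> 0 -> {for x, continuous (drift a j)}.
Proof.
move=> xn0.
have cc i : continuous (fun y : 'rV[R]_d => y ord0 i).
  exact: coord_continuous.
have cs : continuous (fun y : 'rV[R]_d => \sum_i y ord0 i ^+ 2).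
  apply: continuous_big => [|i _ y]; first exact: add_continuous.
  by apply: (@continuousM _ _ (fun y : 'rV[R]_d => y ord0 i)); exact: cc.
have -> : drift a j = fun y =>
    @sigma R d a * (y ord0 j * (\sum_i y ord0 i ^+ 2)^-1).
  by apply/funext => y; rewrite /drift enorm_sqr.
apply: (@continuousM _ _ (cst _)); first exact: cst_continuous.
apply: (@continuousM _ _ (fun y : 'rV[R]_d => y ord0 j)); first exact: cc.
apply: (@continuousV _ _ (fun y : 'rV[R]_d => \sum_i y ord0 i ^+ 2));
  last exact: cs.
by rewrite -enorm_sqr sqrf_eq0; apply/eqP => /enorm_eq0.
Qed.

Lemma A_minus_out psi j x : ~ closure [set x | psi x != 0] x ->
  A_minus a j psi x = 0.
Proof.
move=> nx; rewrite /A_minus; have [_ ->] := partial_compl_support j nx.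
by rewrite (nbhs_singleton (near_compl_support nx)) mulr0 subr0.
Qed.

(** On [V] the drift is continuous; off the support everything vanishes, so the
    singularity at the origin is harmless. *)
Lemma A_minus_continuous V psi j : V `<=` ~` [set 0] -> Ck_c 1 V psi ->
  continuous (A_minus a j psi).
Proof.
move=> V0 Cpsi x.
have [cpsi /(_ j)[cd _]] := Ck_c_C1 Cpsi.
have [_ _ psiV] := Cpsi.
have [/psiV/V0 xn0|nx] := pselect (closure [set x | psi x != 0] x).
  apply: (@continuousB _ _ _ (partial j psi)); first exact: cd.
  apply: (@continuousM _ _ (drift a j)); last exact: cpsi.
  exact: drift_continuous.
apply: (near_cst_continuous (0 : R)).
have oC : open (~` closure [set x | psi x != 0]).
  exact/closed_openC/closed_closure.
apply: filterS (open_nbhs_nbhs (conj oC nx)) => y; exact: A_minus_out.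
Qed.

End A_minus.

(** * Integration by parts against C^1 test functions *)

Section weak.
Context {R : realType} {d : nat} (a : R).
Implicit Types (x y : 'rV[R]_d) (f g psi : 'rV[R]_d -> R) (V : set 'rV[R]_d).
Local Notation mu := (lebesgue_rV d).

Variable Omega : set 'rV[R]_d.
Hypothesis oOmega : open Omega.
Hypothesis Omega0 : Omega `<=` ~` [set 0].

Let mOmega : measurable Omega := open_measurable_rV oOmega.

Lemma Ck_c_bounded_measurable psi : Ck_c 1 Omega psi ->
  bounded_measurable Omega psi.
Proof.
move=> Cpsi; have [_ cK _] := Cpsi.
apply: (bounded_measurable_compact_support mOmega _ cK).
  by case: (Ck_c_C1 Cpsi).
by move=> x /near_compl_support/nbhs_singleton.
Qed.

Lemma partial_bounded_measurable psi j : Ck_c 1 Omega psi ->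
  bounded_measurable Omega (partial j psi).
Proof.
move=> Cpsi; have [_ cK _] := Cpsi.
apply: (bounded_measurable_compact_support mOmega _ cK).
  by have [_ /(_ j)[]] := Ck_c_C1 Cpsi.
by move=> x /(partial_compl_support j)[].
Qed.

Lemma A_minus_bounded_measurable psi j : Ck_c 1 Omega psi ->
  bounded_measurable Omega (A_minus a j psi).
Proof.
move=> Cpsi; have [_ cK _] := Cpsi.
apply: (bounded_measurable_compact_support mOmega _ cK).
  exact: A_minus_continuous Cpsi.
by move=> x; exact: A_minus_out.
Qed.

Lemma A_plus_smooth f g j psi : L1 Omega f -> L1 Omega g ->
  is_A_plus a Omega j f g -> Cinfty_c Omega psi ->
  (\int[mu]_(x in Omega) (f x * A_minus a j psi x)%:E =
   - \int[mu]_(x in Omega) (g x * psi x)%:E)%E.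
Proof.
move=> fi gi fg Cpsi; rewrite (fg psi Cpsi).
have bd := partial_bounded_measurable j (Cpsi 1%N).
have bA := A_minus_bounded_measurable j (Cpsi 1%N).
have i1 := integrable_mul_bounded mOmega fi bd.
have i2 := integrable_mul_bounded mOmega fi bA.
have -> : (\int[mu]_(x in Omega) (drift a j x * f x * psi x)%:E =
    \int[mu]_(x in Omega) (f x * partial j psi x)%:E -
    \int[mu]_(x in Omega) (f x * A_minus a j psi x)%:E)%E.
  rewrite -integralB_EFin//; apply: eq_integral => x _.
  by rewrite -EFinB; congr EFin; rewrite /A_minus; ring.
have f1 := integrable_fin_num mOmega i1.
have f2 := integrable_fin_num mOmega i2.
by rewrite addeA [(- _ + _)%E]addeC subee// add0e oppeK.
Qed.

(** Smooth approximations are taken inside the open set where the drift is bounded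
    by a constant [D] that exceeds its maximum on the support of [psi]. This keeps
    the drift terms dominated. *)
Lemma A_plus_C1 f g j psi : L1 Omega f -> L1 Omega g ->
  is_A_plus a Omega j f g -> Ck_c 1 Omega psi ->
  (\int[mu]_(x in Omega) (f x * A_minus a j psi x)%:E =
   - \int[mu]_(x in Omega) (g x * psi x)%:E)%E.
Proof.
move=> fi gi fg Cpsi; have [_ cK KOmega] := Cpsi.
set K := closure _ in cK KOmega.
(* the strict bound makes the region [|drift| < D] a neighbourhood of [K] *)
have [D driftD] : exists D, forall x, K x -> `|drift a j x| < D.
  have [[x0 Kx0]|nK] := pselect (exists x, K x); last first.
    by exists 0 => x Kx; exfalso; apply: nK; exists x.
  have Kn0 : K !=set0 by exists x0.
  have [|c _ hc] := @EVT_max_rV R d (fun x => `|drift a j x|) K Kn0 cK.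
    apply: continuous_in_subspaceT => x /set_mem Kx.
    apply: (@continuous_comp _ _ _ (drift a j)); last exact: norm_continuous.
    by apply: drift_continuous; apply: Omega0; exact: KOmega.
  exists (`|drift a j c| + 1) => x Kx; rewrite (le_lt_trans (hc x _)) ?ltrDl//.
  by rewrite inE.
pose V := Omega `&` [set x | `|drift a j x| < D].
have oV : open V.
  rewrite openE => x [Ox xD]; apply: filterI; first exact: open_nbhs_nbhs.
  have c : {for x, continuous (fun x => `|drift a j x|)}.
    apply: (@continuous_comp _ _ _ (drift a j)); last exact: norm_continuous.
    by apply: drift_continuous; exact: Omega0.
  have nD : nbhs `|drift a j x| [set t | t < D] by exact: lt_nbhsl.
  exact: (c _ nD).
have CV : Ck_c 1 V psi.
  have [Ck _ _] := Cpsi; split => //; first by move=> s x [/Ck].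
  by move=> x Kx; split; [exact: KOmega|exact: driftD].
have [p_ [B [CpV pB dpB pcvg dpcvg]]] := Ck_c1_smooth_approx j CV oV.
have Cp p : Cinfty_c Omega (p_ p).
  by move=> k; apply: Ck_c_sub (CpV p k) => x [].
have B0 : 0 <= B := le_trans (normr_ge0 _) (pB 0%N 0).
have L :
    (fun p => \int[mu]_(x in Omega) (f x * A_minus a j (p_ p) x)%:E)%E @ \oo -->
    (\int[mu]_(x in Omega) (f x * A_minus a j psi x)%:E)%E.
  apply: (cvg_integral_mul mOmega (B := B + `|D| * B)) => //.
  - by move=> p; case: (A_minus_bounded_measurable j (Cp p 1%N)).
  - move=> p x Ox; rewrite /A_minus (le_trans (ler_normB _ _))// lerD//.
    have [[_ /= xD]|nV] := pselect (V x).
      rewrite normrM ler_pM//; exact: le_trans (ltW xD) (ler_norm _).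
    by rewrite (Ck_c_eq0 (CpV p 0%N) nV) mulr0 normr0 mulr_ge0.
  - move=> x Ox; apply: cvgB; first exact: dpcvg.
    by apply: cvgM; [exact: cvg_cst|exact: pcvg].
  - by case: (A_minus_bounded_measurable j Cpsi).
have L2 : (fun p => \int[mu]_(x in Omega) (g x * p_ p x)%:E)%E @ \oo -->
    (\int[mu]_(x in Omega) (g x * psi x)%:E)%E.
  apply: (cvg_integral_mul mOmega (B := B)) => //.
  - by move=> p; case: (Ck_c_bounded_measurable (Cp p 1%N)).
  - by case: (Ck_c_bounded_measurable Cpsi).
have E : (fun p => \int[mu]_(x in Omega) (f x * A_minus a j (p_ p) x)%:E)%E =
    (fun p => - \int[mu]_(x in Omega) (g x * p_ p x)%:E)%E.
  by apply/funext => p; exact: A_plus_smooth.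
rewrite E in L; have L3 := cvgeN L2.
rewrite -(cvg_lim _ L)//. apply/cvg_lim; last exact: L3.
exact: ereal_hausdorff.
Qed.

(** The Euclidean norm is at most the sum of the absolute values of the
    coordinates. *)
Lemma integrable_enorm (G : 'rV[R]_d -> 'rV[R]_d) :
  (forall j, L1 Omega (fun x => G x ord0 j)) -> L1 Omega (fun x => enorm (G x)).
Proof.
move=> Gi.
have mG j : measurable_fun Omega (fun x => G x ord0 j).
  by apply/measurable_EFinP; exact: measurable_int (Gi j).
apply: (@le_integrable _ _ _ mu Omega mOmega _
    (fun x => \sum_j `|(G x ord0 j)%:E|)%E).
- apply/measurable_EFinP; apply: (@measurableT_comp _ _ _ _ _ _ (@Num.sqrt R)).
    by apply: nondecreasing_measurable => // s t; exact: ler_wsqrtr.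
  by apply: measurable_sum => j; exact: measurable_funX.
- move=> x Ox /=; rewrite sumEFin !lee_fin.
  rewrite (ger0_norm (enorm_ge0 _)); apply: le_trans (ler_norm _).
  rewrite -(@ler_pXn2r _ 2) ?nnegrE ?enorm_ge0 ?sumr_ge0// enorm_sqr.
  elim: (index_enum _) => [|j r IH]; first by rewrite !big_nil expr0n.
  rewrite !big_cons sqrrD real_normK ?num_real//.
  rewrite -addrA lerD2l (le_trans IH)// lerDr mulrn_wge0// mulr_ge0//.
  exact: sumr_ge0.
- by apply: integrable_sum => // j _; exact: integrable_abse (Gi j).
Qed.

Lemma variation_integral f (G phi : 'rV[R]_d -> 'rV[R]_d) : L1 Omega f ->
  is_grad_H a Omega f G -> Ck_c 1 Omega phi ->
  (\int[mu]_(x in Omega) (f x * div_H a phi x)%:E =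
   \int[mu]_(x in Omega) (- \sum_j G x ord0 j * phi x ord0 j)%:E)%E.
Proof.
move=> fi fG Cphi; have Cphij := Ck_c1_coord oOmega Cphi.
pose Aphi j := A_minus a j (fun y => phi y ord0 j).
have i1 j : mu.-integrable Omega (EFin \o (fun x => f x * Aphi j x)).
  by apply: integrable_mul_bounded => //; exact: A_minus_bounded_measurable.
have i2 j : mu.-integrable Omega (EFin \o (fun x => G x ord0 j * phi x ord0 j)).
  apply: integrable_mul_bounded => //; first by case: (fG j).
  exact: Ck_c_bounded_measurable.
transitivity (\sum_j \int[mu]_(x in Omega) (f x * Aphi j x)%:E)%E.
  rewrite -integral_sum//; apply: eq_integral => x _.
  by rewrite sumEFin /div_H mulr_sumr.
transitivity
    (\sum_j \int[mu]_(x in Omega) (- (G x ord0 j * phi x ord0 j))%:E)%E.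
  apply: eq_bigr => j _; have [Gi Gj] := fG j.
  rewrite (A_plus_C1 fi Gi Gj (Cphij j)) -integralN; last first.
    exact: integrable_add_def (i2 j).
  by apply: eq_integral => x _.
rewrite -integral_sum//.
- by apply: eq_integral => x _; rewrite sumEFin sumrN.
- by move=> j; under eq_fun do rewrite EFinN; exact: integrableN (i2 j).
Qed.

End weak.

(** * Variation of W^{1,1} functions and lower semicontinuity *)

Lemma cvg_le_limn_einf (R : realType) (u v : nat -> \bar R) (l : \bar R) :
  u @ \oo --> l -> (forall k, u k <= v k)%E -> (l <= limn_einf v)%E.
Proof.
move=> ul uv; have [<- _] := cvg_limn_einf_sup ul.
rewrite !limn_einf_lim; apply: lee_lim; [exact: is_cvg_einfs..|].
apply: nearW => n; apply: le_ereal_inf_tmp => _ [k /= nk <-].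
by apply: le_trans (uv k); apply: ereal_inf_lbound; exists k.
Qed.

Section theorem.
Context {R : realType} {d : nat} (a : R).
Implicit Types (x y : 'rV[R]_d) (f g psi : 'rV[R]_d -> R) (V : set 'rV[R]_d).
Local Notation mu := (lebesgue_rV d).

Variable Omega : set 'rV[R]_d.
Hypothesis oOmega : open Omega.
Hypothesis Omega0 : Omega `<=` ~` [set 0].

Let mOmega : measurable Omega := open_measurable_rV oOmega.

(** The approximation theorem above for the pi-system of open sets, with the
    interpolated indicators as approximations. *)
Lemma C1_c_dense (w u : 'rV[R]_d -> R) (e : R) : L1 Omega w ->
  bounded_measurable Omega u -> 0 < e ->
  exists2 g, Ck_c 1 Omega g &
    (\int[mu]_(x in Omega) (`|w x| * `|u x - g x|)%:E < e%:E)%E.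
Proof.
move=> wi bu e0.
have open_cvg U : open U -> exists (g : nat -> 'rV[R]_d -> R) (B : R),
    [/\ forall p, Ck_c 1 Omega (g p), forall p x, Omega x -> `|g p x| <= B &
        forall x, Omega x -> (fun p => g p x) @ \oo --> (\1_U x : R)].
  move=> oU.
  have [g [B [gU gB g1 g0]]] := open_indicator_approx (openI oU oOmega).
  exists g, B; split => // [p|x Ox].
    by apply: Ck_c_sub (gU p 1%N) => x [].
  rewrite indicE; have [xU|xU] := boolP (x \in U).
    by apply: g1; split => //; exact: set_mem.
  rewrite (_ : (fun p => g p x) = cst 0); first exact: cvg_cst.
  by apply/funext => p; apply: g0 => -[Ux _]; rewrite mem_set in xU.
by have [_ /(_ e e0)] := approximable_bounded_measurable mOmega wi
  (A := [set g | Ck_c 1 Omega g]) (@Ck_c_bounded_measurable _ _ _ oOmega)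
  (fun c g h => @Ck_c1_lin _ _ Omega c g h) openT (@openI _)
  (@measurable_rV_borel R d) open_cvg bu.
Qed.

Lemma variation_W11 f (G : 'rV[R]_d -> 'rV[R]_d) : L1 Omega f ->
  is_grad_H a Omega f G ->
  variation_H a Omega f = (\int[mu]_(x in Omega) (enorm (G x))%:E)%E.
Proof.
move=> fi fG.
have Gi j : L1 Omega (fun x => G x ord0 j) by case: (fG j).
have wi := integrable_enorm oOmega Gi.
have mG j : measurable_fun Omega (fun x => G x ord0 j).
  by apply/measurable_EFinP; exact: measurable_int (Gi j).
have mw : measurable_fun Omega (fun x => enorm (G x)).
  by apply/measurable_EFinP; exact: measurable_int wi.
have i2 (phi : 'rV[R]_d -> 'rV[R]_d) : Ck_c 1 Omega phi ->
    mu.-integrable Omega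
      (EFin \o (fun x => - \sum_j G x ord0 j * phi x ord0 j)).
  move=> Cphi; have : mu.-integrable Omega
      (fun x => \sum_j (- (G x ord0 j * phi x ord0 j))%:E)%E.
    apply: integrable_sum => // j _; under eq_fun do rewrite EFinN.
    apply: integrableN; apply: (integrable_mul_bounded mOmega (Gi j)).
    exact: (Ck_c_bounded_measurable oOmega (Ck_c1_coord oOmega Cphi j)).
  by under eq_fun do rewrite sumEFin sumrN.
apply/eqP; rewrite eq_le; apply/andP; split.
  apply: ge_ereal_sup => _ [phi [Cphi phi1] <-].
  rewrite (variation_integral oOmega Omega0 fi fG Cphi).
  apply: le_integral => //; first exact: i2.
  move=> x /set_mem Ox; rewrite lee_fin.
  apply: dot_le_norm; [exact: enorm_ge0|exact: enorm_sqr|].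
  by rewrite -enorm_sqr expr_le1// ?enorm_ge0//; exact: phi1.
apply/lee_addgt0Pr => e e0.
have Gle x j : `|G x ord0 j| <= enorm (G x).
  rewrite -(@ler_pXn2r _ 2) ?nnegrE ?enorm_ge0// real_normK ?num_real//.
  by rewrite enorm_sqr (bigD1 j)//= lerDl sumr_ge0// => i _; exact: sqr_ge0.
pose u j x := - (G x ord0 j / enorm (G x)).
have bu j : bounded_measurable Omega (u j).
  rewrite /u; split.
    apply: measurableT_comp => //; apply: measurable_funM => //.
    rewrite (_ : (fun x => (enorm (G x))^-1) = fun x => (enorm (G x)) `^ (-1)).
      exact: (@measurableT_comp _ _ _ _ _ _ (fun t : R => t `^ (-1))).
    by apply/funext => x; rewrite powR_inv1// enorm_ge0.
  exists 1 => x Ox; rewrite normrN normrM normfV (ger0_norm (enorm_ge0 _)).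
  have [->|wn0] := eqVneq (enorm (G x)) 0; first by rewrite invr0 mulr0.
  by rewrite ler_pdivrMr ?mul1r// lt_def wn0 enorm_ge0.
(* [d + 1] avoids a division by [0]; the errors add up to [2 d e' <= e] *)
pose e' := e / (2 * d.+1%:R).
have e'0 : 0 < e' by rewrite divr_gt0// mulr_gt0.
have /choice[g gP] j : exists g, Ck_c 1 Omega g /\
    (\int[mu]_(x in Omega) (`|enorm (G x)| * `|u j x - g x|)%:E < e'%:E)%E.
  by have [g Cg ge] := C1_c_dense wi (bu j) e'0; exists g.
have Cg j : Ck_c 1 Omega (g j) by case: (gP j).
pose den x := 1 + \sum_i g i x * g i x.
have den0 x : den x != 0.
  by rewrite gt_eqF// ltr_pwDl// sumr_ge0// => i _; rewrite -expr2 sqr_ge0.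
pose phi x : 'rV[R]_d := \row_j (2 * g j x * (den x)^-1).
have Cphi : Ck_c 1 Omega phi.
  apply: Ck_c1_row => j; have [_ cK KO] := Cg j.
  apply: (C1_Ck_c _ cK KO).
    have C1g i := Ck_c_C1 (Cg i).
    apply: C1M; first by apply: C1M => //; exact: C1_cst.
    apply: C1V => //; apply: C1D; first exact: C1_cst.
    by apply: C1_sum => i; exact: C1M.
  by move=> x /near_compl_support/nbhs_singleton ->; rewrite mulr0 mul0r.
have phi1 x : Omega x -> enorm (phi x) <= 1.
  move=> _; rewrite -(@expr_le1 _ 2)// ?enorm_ge0// enorm_sqr.
  under eq_bigr do rewrite mxE.
  exact: (normalised_field_le1 (fun j => g j x)).
have i3 j : mu.-integrable Omega
    (EFin \o (fun x => `|enorm (G x)| * `|u j x - g j x|)).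
  apply: (integrable_mul_bounded mOmega (integrable_abse wi)).
  apply: bounded_measurable_norm; apply: bounded_measurableB => //.
  exact: Ck_c_bounded_measurable.
pose rest x := \sum_j `|enorm (G x)| * `|u j x - g j x|.
have irest : mu.-integrable Omega (EFin \o rest).
  have : mu.-integrable Omega (fun x => \sum_j
     (`|enorm (G x)| * `|u j x - g j x|)%:E)%E.
    by apply: integrable_sum => // j _; exact: i3.
  by under eq_fun do rewrite sumEFin.
apply: (@le_trans _ _ (\int[mu]_(x in Omega)
    ((- \sum_j G x ord0 j * phi x ord0 j)%:E + 2%:E * (rest x)%:E))%E).
  apply: le_integral => //.
    by apply: integrableD => //; [exact: i2|exact: integrableZl].
  move=> x /set_mem Ox; rewrite -EFinM -EFinD lee_fin.
  have := norm_le_dot (fun j => g j x) (enorm_ge0 (G x)) (enorm_sqr (G x)).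
  rewrite /rest (ger0_norm (enorm_ge0 _)).
  by under [X in _ -> _ <= - X + _]eq_bigr do rewrite mxE.
rewrite integralD//; [|exact: i2|exact: integrableZl].
apply: leeD.
  rewrite -(variation_integral oOmega Omega0 fi fG Cphi).
  by apply: ereal_sup_ubound; exists phi.
rewrite integralZl//.
have -> : (\int[mu]_(x in Omega) (rest x)%:E = \sum_j \int[mu]_(x in Omega)
    (`|enorm (G x)| * `|u j x - g j x|)%:E)%E.
  by rewrite -integral_sum//; apply: eq_integral => x _; rewrite sumEFin.
apply: (@le_trans _ _ (2%:E * \sum_(j < d) e'%:E)%E).
  by rewrite lee_wpmul2l//; apply: lee_sum => j _; exact: ltW (gP j).2.
rewrite sumEFin -EFinM lee_fin sumr_const card_ord -[_ *+ d]mulr_natr /e'.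
have d1 : d%:R <= d.+1%:R :> R by rewrite ler_nat.
have : 0 < d.+1%:R :> R by [].
move: d1; move: (d.+1%:R) => D dD D0.
have -> : 2 * (e / (2 * D) * d%:R) = e * (d%:R / D) by field; rewrite gt_eqF.
by rewrite ger_pMr// ler_pdivrMr// mul1r.
Qed.

Lemma variation_lsc (f_ : nat -> 'rV[R]_d -> R) f : cvg_L1_loc Omega f_ f ->
  (variation_H a Omega f <= limn_einf (fun k => variation_H a Omega (f_ k)))%E.
Proof.
move=> [f_loc f_loc0 f_cvg]; apply: ge_ereal_sup => _ [phi [Cphi phi1] <-].
have Cphij := Ck_c1_coord oOmega Cphi.
have [_ cK KO] := Cphi; set K := closure _ in cK KO.
have mK := compact_measurable_rV cK.
have [mdiv [B divB]] : bounded_measurable Omega (div_H a phi).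
  have H (r : seq 'I_d) : bounded_measurable Omega
      (fun x => \sum_(j <- r) A_minus a j (fun y => phi y ord0 j) x).
    elim: r => [|j r IH].
      under eq_fun do rewrite big_nil; split => //; exists 0 => x _.
      by rewrite normr0.
    under eq_fun do rewrite big_cons; apply: bounded_measurableD => //.
    exact: A_minus_bounded_measurable.
  exact: H.
have div0 x : ~ K x -> div_H a phi x = 0.
  move=> nK; rewrite /div_H big1// => j _; apply: A_minus_out.
  apply: contra_not nK; apply: closure_subset => y /=.
  by apply: contraNN => /eqP ->; rewrite mxE.
have bK : bounded_measurable K (div_H a phi).
  split; first exact: measurable_funS mdiv.
  by exists B => x /KO; exact: divB.
have toK h : (\int[mu]_(x in Omega) (h x * div_H a phi x)%:E =
    \int[mu]_(x in K) (h x * div_H a phi x)%:E)%E.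
  rewrite [LHS]integral_mkcond [RHS]integral_mkcond; apply: eq_integral => x _.
  rewrite !patchE; have [xK|xK] := boolP (x \in K).
    by rewrite mem_set//; apply: KO; exact: set_mem.
  have nKx : ~ K x by move=> /mem_set; exact/negP.
  by rewrite div0// mulr0 if_same.
have fK : L1 K f by have [_] := f_loc0; exact.
have fkK k : L1 K (f_ k) by have [_] := f_loc k; exact.
have intf := integrable_mul_bounded mK fK bK.
have intfk k := integrable_mul_bounded mK (fkK k) bK.
apply: (@cvg_le_limn_einf _ (fun k =>
  \int[mu]_(x in Omega) (f_ k x * div_H a phi x)%:E)%E); last first.
  by move=> k; apply: ereal_sup_ubound; exists phi.
rewrite toK; under eq_fun do rewrite toK.
apply/sube_cvg0; first exact: integrable_fin_num.
apply/cvg_abse0P.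
have B0 : 0 <= `|B| := normr_ge0 _.
apply: (@squeeze_cvge _ _ _ _ (cst 0%E) _
  (fun k => `|B|%:E * \int[mu]_(x in K) (`|f_ k x - f x|)%:E)%E).
- apply: nearW => k; rewrite abse_ge0/= -integralB_EFin//.
  have intB : mu.-integrable K (EFin \o (fun x => `|f_ k x - f x|)).
    exact: (integrable_abse (integrableB mK (fkK k) fK)).
  have intD := integrableB mK (intfk k) intf.
  rewrite -integralZl//.
  apply: le_trans (le_abse_integral _ _ _) _ => //.
    exact: measurable_int intD.
  apply: le_integral => //.
  + exact: (integrable_abse intD).
  + exact: integrableZl.
  + move=> x /set_mem Kx /=; rewrite lee_fin -mulrBl normrM mulrC.
    by rewrite ler_wpM2r// (le_trans (divB x (KO _ Kx)))// ler_norm.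
- exact: cvg_cst.
- rewrite -(mule0 `|B|%:E); apply: cvgeZl => //; exact: f_cvg.
Qed.

End theorem.

Theorem lemma2p2 (R : realType) (d : nat) (a : R) (Omega : set 'rV[R]_d)
    (d_ge2 : (2 <= d)%N) (a_ge : - (d%:R / 2 - 1) ^+ 2 <= a)
    (Omega_domain : domain Omega) (Omega0 : Omega `<=` ~` [set 0]) :
  (forall (f : 'rV[R]_d -> R) (gradf : 'rV[R]_d -> 'rV[R]_d),
      W11_H a Omega f -> is_grad_H a Omega f gradf ->
      variation_H a Omega f =
        (\int[lebesgue_rV d]_(x in Omega) (enorm (gradf x))%:E)%E) /\
  (forall (f_ : nat -> 'rV[R]_d -> R) (f : 'rV[R]_d -> R),
      (forall k, BV_H a Omega (f_ k)) -> cvg_L1_loc Omega f_ f ->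
      (variation_H a Omega f <=
        limn_einf (fun k => variation_H a Omega (f_ k)))%E).
Proof.
have [oOmega _ _] := Omega_domain.
split=> [f gradf [fi _] fG|f_ f _ f_f].
  exact: variation_W11.
exact: variation_lsc.
Qed.
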